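(* Let $m,f$ be integers such that there exist positive integers $a,b,c$ with $f=\binom{a}{2}=\binom{m}{2}-\binom{b}{2}=c(m-c)$. Let $r$ be the smallest integer such that $f$ can be written as $f=\sum_{i=1}^{r+1}\binom{x_i}{2}$ with integers $x_i\ge 1$ satisfying $\sum_{i=1}^{r+1}x_i=m$. If $r=2$ or $r\ge 5$, then $\sigma(m,f)=\frac1r$.
   Context: All graphs are finite and simple. For integers $m\ge 2$ and $0\le f\le \binom{m}{2}$, write $(n,e)\rightarrow(m,f)$ if every $n$-vertex graph with exactly $e$ edges contains an induced subgraph on $m$ vertices with exactly $f$ edges. Let $S_n(m,f)=\{e\in\{0,1,\dots,\binom n2\}: (n,e)\rightarrow(m,f)\}$ and $\sigma(m,f)=\limsup_{n\to\infty}|S_n(m,f)|/\binom{n}{2}$. *)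

(* Defs.v *)
From mathcomp Require Import all_boot all_order all_algebra.
From mathcomp Require Import reals topology normedtype sequences.

Set Implicit Arguments.
Unset Strict Implicit.
Unset Printing Implicit Defensive.

Import GRing.Theory Num.Theory.

(* A simple graph on V is given by its edge set, a set of 2-element subsets of V. *)
Definition simple_graph (V : finType) (E : {set {set V}}) : bool :=
  [forall X in E, #|X| == 2].

Definition induced_edges (V : finType) (E : {set {set V}}) (A : {set V}) :
  {set {set V}} := [set X in E | X \subset A]%SET.

(* (n, e) -> (m, f) *)
Definition arrow (n e m f : nat) : bool :=
  [forall E : {set {set 'I_n}}, simple_graph E && (#|E| == e) ==>
    [exists A : {set 'I_n}, (#|A| == m) && (#|induced_edges E A| == f)]].

Definition S_set (n m f : nat) : {set 'I_('C(n, 2)).+1} :=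
  [set e : 'I_('C(n, 2)).+1 | arrow n e m f]%SET.

(* The terms n = 0, 1 have denominator 0; they do not affect the limsup. *)
Definition sigma (R : realType) (m f : nat) : R :=
  limn_sup (fun n : nat => (#|S_set n m f|%:R / 'C(n, 2)%:R)%R : R).

Definition sum_of_binomials (m f k : nat) : Prop :=
  exists x : 'I_k -> nat,
    [/\ forall i, 1 <= x i, \sum_(i < k) x i = m
      & f = \sum_(i < k) 'C(x i, 2)].

(* Main.v *)
Require Import Defs.
From mathcomp Require Import all_boot all_order all_algebra.
From mathcomp Require Import zify ring lra.
From mathcomp Require Import reals topology normedtype sequences.

Set Implicit Arguments.
Unset Strict Implicit.
Unset Printing Implicit Defensive.

Import Order.TTheory GRing.Theory Num.Theory.

(** For n^2 / q <= e <= (1 / r - 1 / q) n^2 / 2, every graph with n vertices and e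
    edges contains one of the four m-vertex graphs of size f.  Being dense, it
    contains by Erdos-Stone and Ramsey two large completely joined sets, each a
    clique or independent; two independent sets contain K_{c,m-c}, a clique joined
    to an independent set contains K_m minus K_b, and otherwise there is a
    large clique.  The complement is denser than the r-partite Turan graph, so it
    contains a complete (r+1)-partite graph with large parts: either some part
    contains a large independent set, which together with the large clique yields
    (bipartite Ramsey) K_m minus K_b or K_a with isolated vertices, or all
    parts contain large cliques, and then the disjoint cliques K_{x_i} are found.

    All larger e fail, up to O(n).  A disjoint union of r cliques contains no
    m-vertex graph of size f, by minimality of r, and a graph containing two
    disjoint cliques that cover it has too many edges on every m-set once
    f < C(x,2) + C(m-x,2) for all x.  The latter settles e >= n^2 / 4 + O(n), hence
    r = 2.  For r >= 5 every remaining e is a sum of C(x_i,2) over r parts with sum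
    n: by Cauchy's lemma this reduces to representing a number 3 mod 8 as a sum of
    three squares.  That theorem is obtained by counting.  The number of
    representations of 4 k (k odd) by four odd squares is sigma(k) (Jacobi, via an
    involution giving a recursion), and by reduction of 2 x 2 integer matrices under
    the congruence group Gamma(2) the same number counts solutions of
    w^2 + (x y + y z + z x) = 4 k with w odd and x = y = z mod 4 odd.  Inverting the
    convolution with the odd squares w^2 shows that D = 3 mod 8 has as many
    representations as a sum of three odd squares as solutions of
    x y + y z + z x = D, and (1, 1, (D - 1) / 2) is one. *)

Local Open Scope ring_scope.

(** * Reduction of integer matrices under Gamma(2) *)

Record mat := Mat { m11 : int; m12 : int; m21 : int; m22 : int }.

Definition mdet M := m11 M * m22 M - m12 M * m21 M.

Definition gact (a b c d : int) M :=
  Mat (a * m11 M + b * m21 M) (a * m12 M + b * m22 M)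
      (c * m11 M + d * m21 M) (c * m12 M + d * m22 M).

(** The group acts by left multiplication alone, not by congruence on the quadratic form.
    Determinant and parity of [m12] are therefore invariants, and orbits can be counted by two
    different systems of normal forms. *)
Definition gamma2 (M M' : mat) : Prop := exists a b c d : int,
  (1 + 2 * a) * (1 + 2 * d) - (2 * b) * (2 * c) = 1 /\
  M' = gact (1 + 2 * a) (2 * b) (2 * c) (1 + 2 * d) M.

(* Selling's parameters of the quadratic form [m11 x^2 + (m12 + m21) x y + m22 y^2]. *)
Definition conorm1 M := 2 * m11 M - m12 M - m21 M.
Definition conorm2 M := m12 M + m21 M.
Definition conorm3 M := 2 * m22 M - m12 M - m21 M.

Definition obtuse M := [/\ 0 < conorm1 M, 0 < conorm2 M & 0 < conorm3 M].

Definition oddz (x : int) := (x %% 2)%Z == 1.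

(** Under this parity condition [m11], [m22], their sum minus the off-diagonal entries, and all
    three conorms are odd. None of them vanishes, so the reduction below meets no boundary case. *)
Definition odd_form M := [&& oddz (m11 M), oddz (m22 M) & oddz (m12 M + m21 M)].

Lemma gamma2_refl M : gamma2 M M.
Proof.
exists 0, 0, 0, 0; split; first by [].
by case: M => X u v Z; rewrite /gact /=; congr Mat; ring.
Qed.

Lemma gamma2_sym M M' : gamma2 M M' -> gamma2 M' M.
Proof.
move=> [a [b [c [d [det1 ->]]]]]; exists d, (- b), (- c), a.
split; first by rewrite -[RHS]det1; ring.
case: M => X u v Z; rewrite /gact /=; congr Mat.
- by rewrite -[LHS]mul1r -[Y in Y * _ = _]det1; ring.
- by rewrite -[LHS]mul1r -[Y in Y * _ = _]det1; ring.
- by rewrite -[LHS]mul1r -[Y in Y * _ = _]det1; ring.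
- by rewrite -[LHS]mul1r -[Y in Y * _ = _]det1; ring.
Qed.

Lemma gamma2_trans M1 M2 M3 : gamma2 M1 M2 -> gamma2 M2 M3 -> gamma2 M1 M3.
Proof.
move=> [a [b [c [d [det1 ->]]]]] [a' [b' [c' [d' [det1' ->]]]]].
exists (a + a' + 2 * a * a' + 2 * b' * c), (b + 2 * a' * b + b' + 2 * b' * d),
  (c' + 2 * c' * a + c + 2 * d' * c), (d + d' + 2 * d * d' + 2 * c' * b).
split.
  rewrite -[RHS]mul1r -[Y in _ = Y * _]det1 -[Y in _ = _ * Y]det1'; ring.
by case: M1 => X u v Z; rewrite /gact /=; congr Mat; ring.
Qed.

Lemma gamma2_det M M' : gamma2 M M' -> mdet M' = mdet M.
Proof.
move=> [a [b [c [d [det1 ->]]]]]; rewrite /mdet /gact /=.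
by rewrite -[RHS]mul1r -[Y in _ = Y * _]det1; ring.
Qed.

Lemma gamma2_odd M M' : gamma2 M M' -> odd_form M -> odd_form M'.
Proof.
move=> [a [b [c [d [_ ->]]]]] /and3P[]; rewrite /odd_form /oddz /gact /= => h1 h2 h3.
set X := m11 M in h1 *; set u := m12 M in h3 *; set v := m21 M in h3 *; set Z := m22 M in h2 *.
have E1 : (1 + 2 * a) * X + 2 * b * v = X + 2 * (a * X + b * v) by ring.
have E2 : 2 * c * u + (1 + 2 * d) * Z = Z + 2 * (c * u + d * Z) by ring.
have E3 : (1 + 2 * a) * u + 2 * b * Z + (2 * c * X + (1 + 2 * d) * v)
  = (u + v) + 2 * (a * u + b * Z + c * X + d * v) by ring.
rewrite E1 E2 E3.
move: (a * X + b * v) (c * u + d * Z) (a * u + b * Z + c * X + d * v) => x y z.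
by apply/and3P; split; lia.
Qed.

(** This is the congruence [R M R^T] with [R] having rows (0, 1) and (-1, 1), so that [R^3 = -1]. It
    permutes the three conorms cyclically, and [mrefl], the congruence by the coordinate swap,
    exchanges the first and the third. Both congruences normalise Gamma(2), which reduces later case
    distinctions to one representative. *)
Definition mrot M := Mat (m22 M) (m22 M - m21 M) (m22 M - m12 M)
  (m11 M + m22 M - m12 M - m21 M).
Definition mrefl M := Mat (m22 M) (m21 M) (m12 M) (m11 M).

Lemma mrot3 M : mrot (mrot (mrot M)) = M.
Proof. by case: M => X u v Z; rewrite /mrot /=; congr Mat; ring. Qed.

Lemma mreflK M : mrefl (mrefl M) = M.
Proof. by case: M. Qed.

Lemma gamma2_rot M M' : gamma2 M M' -> gamma2 (mrot M) (mrot M').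
Proof.
move=> [a [b [c [d [det1 ->]]]]].
exists (c + d), (- c), (c + d - a - b), (a - c); split; first by rewrite -[RHS]det1; ring.
by case: M => X u v Z; rewrite /mrot /gact /=; congr Mat; ring.
Qed.

Lemma gamma2_mrefl M M' : gamma2 M M' -> gamma2 (mrefl M) (mrefl M').
Proof.
move=> [a [b [c [d [det1 ->]]]]].
exists d, c, b, a; split; first by rewrite -[RHS]det1; ring.
by case: M => X u v Z; rewrite /mrefl /gact /=; congr Mat; ring.
Qed.

Lemma obtuse_rot M : obtuse M -> obtuse (mrot M).
Proof. by case: M => X u v Z; rewrite /obtuse /conorm1 /conorm2 /conorm3 /= => -[]; split; lia. Qed.

Lemma obtuse_mrefl M : obtuse M -> obtuse (mrefl M).
Proof. by case: M => X u v Z; rewrite /obtuse /conorm1 /conorm2 /conorm3 /= => -[]; split; lia. Qed.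

Definition reducible M := exists2 M', gamma2 M M' & obtuse M'.

Lemma reducible_step M M' : gamma2 M M' -> reducible M' -> reducible M.
Proof. by move=> h [M'' h' o]; exists M'' => //; apply: gamma2_trans h h'. Qed.

Lemma reducible_rot M : reducible (mrot M) -> reducible M.
Proof.
move=> [M' h o]; exists (mrot (mrot M')); last exact/obtuse_rot/obtuse_rot.
by rewrite -{1}(mrot3 M); apply/gamma2_rot/gamma2_rot.
Qed.

Lemma reducible_mrefl M : reducible (mrefl M) -> reducible M.
Proof.
move=> [M' h o]; exists (mrefl M'); last exact/obtuse_mrefl.
by rewrite -{1}(mreflK M); apply/gamma2_mrefl.
Qed.

Definition mopp M := Mat (- m11 M) (- m12 M) (- m21 M) (- m22 M).

Lemma gamma2_opp M : gamma2 M (mopp M).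
Proof.
exists (-1), 0, 0, (-1); split; first by [].
by case: M => X u v Z; rewrite /mopp /gact /=; congr Mat; ring.
Qed.

(** The value of the form at (1, -1). With [m11] and [m22] it gives one value for each nonzero class
    of vectors modulo 2; twice these three values are the pairwise sums of the conorms. *)
Definition mtr M := m11 M + m22 M - m12 M - m21 M.

Definition pos_mat M := [/\ 0 < m11 M, 0 < m22 M & 0 < mtr M].

Definition conorms_gt (b : int) M :=
  [/\ b < conorm1 M, b < conorm2 M & b < conorm3 M].

Definition conorms_small (b : int) M :=
  conorms_gt (- b) M /\ conorms_gt (- b) (mopp M).

Ltac mat_unfold :=
  rewrite /conorms_small /conorms_gt /pos_mat /obtuse /odd_form /oddz
    /mtr /conorm1 /conorm2 /conorm3 /mdet /mopp /mrot /mrefl /=.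

Lemma odd_form_rot M : odd_form M -> odd_form (mrot M).
Proof. by case: M => X u v Z; mat_unfold => /and3P[? ? ?]; apply/and3P; split; lia. Qed.

Lemma odd_form_mrefl M : odd_form M -> odd_form (mrefl M).
Proof. by case: M => X u v Z; mat_unfold => /and3P[? ? ?]; apply/and3P; split; lia. Qed.

Lemma odd_form_opp M : odd_form M -> odd_form (mopp M).
Proof. by case: M => X u v Z; mat_unfold => /and3P[? ? ?]; apply/and3P; split; lia. Qed.

Lemma mdet_rot M : mdet (mrot M) = mdet M.
Proof. by case: M => X u v Z; rewrite /mdet /=; ring. Qed.

Lemma mdet_mrefl M : mdet (mrefl M) = mdet M.
Proof. by case: M => X u v Z; rewrite /mdet /=; ring. Qed.

Lemma mdet_opp M : mdet (mopp M) = mdet M.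
Proof. by case: M => X u v Z; rewrite /mdet /=; ring. Qed.

(* [A] is minus the negative conorm. *)
Lemma pos_step M (A : int) : odd_form M -> pos_mat M -> conorm2 M = - A -> 0 < A ->
    0 < m11 M - m22 M + m21 M - m12 M ->
  exists2 M', gamma2 M M' &
    (pos_mat M' /\ conorms_gt (- A) M') \/ conorms_small (A + 1) M'.
Proof.
case: M => X u v Z /= oM pM hA A0 tau.
(* Write [tau] for the quantity assumed positive. Adding twice the second row to the first turns the
   conorms into [2 tau - A], [2 Z - A] and [A], and [mtr] into [tau]. *)
exists (Mat (X + 2 * v) (u + 2 * Z) v Z).
  by exists 0, 1, 0, 0; split=> //; rewrite /gact /=; congr Mat; ring.
move: oM pM hA; mat_unfold => /and3P[h1 h2 h3] [p1 p2 p3] hA.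
have [X'0|X'0] : 0 < X + 2 * v \/ X + 2 * v < 0 by lia.
- by left; do !split; lia.
(* The first two conorms now have the negative sum [2 (X + 2 v)], and both exceed [- A]; hence both
   are below [A]. *)
- by right; do !split; lia.
Qed.

Lemma mixed_step M (B : int) : odd_form M -> 0 < mdet M -> conorm2 M = B ->
    0 < m11 M -> 0 < m22 M -> mtr M < 0 -> 0 < m21 M - m12 M ->
  exists2 M', gamma2 M M' &
    (pos_mat M' /\ conorms_gt (- B) M') \/ conorms_small B M'.
Proof.
case: M => X u v Z /= oM dM hB X0 Z0 N0 w0.
have [a0|a0] : 2 * X - u - v < 0 \/ 0 < 2 * X - u - v.
  by move: oM; mat_unfold => /and3P[? ? ?]; lia.
- exists (Mat X u (v - 2 * X) (Z - 2 * u)).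
    by exists 0, 0, (-1), 0; split=> //; rewrite /gact /=; congr Mat; ring.
  (* Positivity of the determinant is used through [4 det = (X + Z)^2 - (X - Z)^2 - (u + v)^2 + (v -
     u)^2]: as [X + Z < u + v], the antisymmetric part [v - u] must be large. This keeps the new
     third conorm above [- B]. *)
  have wn : - (X + Z - u - v) < v - u.
    rewrite ltNge; apply/negP => hw.
    move: dM N0; rewrite /mdet /mtr /= => dM N0.
    have h1 : (v - u) * (v - u) <= (X + Z - u - v) * (X + Z - u - v) by nia.
    have h2 : 0 <= (X - Z) * (X - Z) by exact: sqr_ge0.
    have h3 : (X + Z - u - v) * (X + Z) < 0 by rewrite pmulr_llt0 // addr_gt0.
    lia.
  move: oM hB N0; mat_unfold => /and3P[h1 h2 h3] hB N0.
  have [g0|g0] := ltP (2 * (Z - 2 * u) - u - (v - 2 * X)) B.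
  + by right; do !split; lia.
  + by left; do !split; lia.
(* The rows (-3, 2) and (-2, 1) of the multiplier come from composing the move of the first case
   with the move of [pos_step]. *)
- exists (Mat (2 * v - 3 * X) (2 * Z - 3 * u) (v - 2 * X) (Z - 2 * u)).
    by exists (-2), 1, (-1), 0; split=> //; rewrite /gact /=; congr Mat; ring.
  have wn : 2 * X - u - v - (X + Z - u - v) < v - u.
    rewrite ltNge; apply/negP => hw.
    move: dM N0; rewrite /mdet /mtr /= => dM N0.
    have h1 : (v - u) * (v - u) <= (X - Z) * (X - Z) by nia.
    have h2 : 0 <= (X + Z - u - v) * (X + Z - u - v) by exact: sqr_ge0.
    have h3 : (X + Z - u - v) * (X + Z) < 0 by rewrite pmulr_llt0 // addr_gt0.
    lia.
  move: oM hB N0; mat_unfold => /and3P[h1 h2 h3] hB N0.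
  have [g0|g0] := ltP (2 * Z - 3 * u + (v - 2 * X)) B.
  + by right; do !split; lia.
  + by left; do !split; lia.
Qed.

Lemma conorms_small_rot (b : int) M : conorms_small b M -> conorms_small b (mrot M).
Proof.
by case: M => X u v Z; mat_unfold => -[[? ? ?] [? ? ?]]; do !split; lia.
Qed.

Lemma conorms_small_mrefl (b : int) M : conorms_small b M -> conorms_small b (mrefl M).
Proof.
by case: M => X u v Z; mat_unfold => -[[? ? ?] [? ? ?]]; do !split; lia.
Qed.

Lemma conorms_small_opp (b : int) M : conorms_small b M -> conorms_small b (mopp M).
Proof.
by case: M => X u v Z; mat_unfold => -[[? ? ?] [? ? ?]]; do !split; lia.
Qed.

Lemma reducible_opp M : reducible (mopp M) -> reducible M.
Proof. exact/reducible_step/gamma2_opp. Qed.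

(** Descent on a bound for the conorms. A positive matrix with a negative conorm [- A] moves to a
    positive one with all conorms above [- A], or to one with all conorms at most [A] in absolute
    value. A matrix of mixed signs with [conorm2 = B] moves to a positive one with conorms above
    [- B], or to one with conorms strictly within [B]. *)
Lemma reducible_ind (b : nat) :
  (forall M, odd_form M -> 0 < mdet M -> pos_mat M -> conorms_gt (- b%:Z) M ->
     reducible M) /\
  (forall M, odd_form M -> 0 < mdet M -> conorms_small b M -> reducible M).
Proof.
elim/ltn_ind: b => b IH.
(* Two of the values [m11], [m22], [mtr] share a sign. Rotation and negation make these two [m11]
   and [m22], and make them positive; only the sign of [mtr] remains to be distinguished. *)
have small M : odd_form M -> 0 < mdet M -> conorms_small b M -> reducible M.
  have mixed M1 : odd_form M1 -> 0 < mdet M1 -> conorms_small b M1 ->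
      0 < m11 M1 -> 0 < m22 M1 -> mtr M1 < 0 -> reducible M1.
    wlog w0 : M1 / 0 < m21 M1 - m12 M1.
      move=> wl oM dM sM X0 Z0 N0.
      have [w0|w0] : 0 < m21 M1 - m12 M1 \/ 0 < m12 M1 - m21 M1.
        by move: oM; mat_unfold => /and3P[? ? ?]; lia.
      - exact: wl.
      - apply: reducible_mrefl; apply: wl => //.
        + exact: odd_form_mrefl.
        + by rewrite mdet_mrefl.
        + exact: conorms_small_mrefl.
        + by move: N0; rewrite /mtr /=; lia.
    move=> oM dM sM X0 Z0 N0.
    have Bb : 0 < conorm2 M1 < b.
      by move: sM N0; mat_unfold => -[[? ? ?] [? ? ?]]; lia.
    have [B EB] : exists B : nat, conorm2 M1 = B%:Z by exists `|conorm2 M1|%N; lia.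
    have Blt : (B < b)%N by lia.
    have [M2 g12 h] := mixed_step oM dM EB X0 Z0 N0 w0.
    have oM2 := gamma2_odd g12 oM.
    have dM2 : 0 < mdet M2 by rewrite (gamma2_det g12).
    apply: reducible_step g12 _; have [IH1 IH2] := IH B Blt.
    by case: h => [[p c]|c]; [apply: IH1 | apply: IH2].
  have two M1 : odd_form M1 -> 0 < mdet M1 -> conorms_small b M1 ->
      0 < m11 M1 -> 0 < m22 M1 -> reducible M1.
    move=> oM dM sM X0 Z0.
    have [N0|N0] : mtr M1 < 0 \/ 0 < mtr M1.
      by move: oM; mat_unfold => /and3P[? ? ?]; lia.
    - exact: mixed.
    - have b0 : (0 < b)%N by move: sM; mat_unfold => -[[? ? ?] [? ? ?]]; lia.
      (* For a positive matrix the conorms have positive pairwise sums, so upper bounds [b] on them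
         also improve the lower bounds, enough to descend to [b - 1]. *)
      have b1 : (b.-1 < b)%N by lia.
      have [IH1 _] := IH _ b1.
      apply: IH1 => //; move: sM N0; mat_unfold => -[[? ? ?] [? ? ?]] N0.
      by move: oM; mat_unfold => /and3P[? ? ?]; split; lia.
  have two' M1 : odd_form M1 -> 0 < mdet M1 -> conorms_small b M1 ->
      0 < m11 M1 -> reducible M1.
    move=> oM dM sM X0.
    have [Z0|Z0] : 0 < m22 M1 \/ m22 M1 < 0.
      by move: oM; mat_unfold => /and3P[? ? ?]; lia.
    - exact: two.
    have [N0|N0] : mtr M1 < 0 \/ 0 < mtr M1.
      by move: oM; mat_unfold => /and3P[? ? ?]; lia.
    - apply: reducible_rot; apply: reducible_opp; apply: two => /=; last 2 first.
      + by lia.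
      + by move: N0; rewrite /mtr; lia.
      + exact/odd_form_opp/odd_form_rot.
      + by rewrite mdet_opp mdet_rot.
      + exact/conorms_small_opp/conorms_small_rot.
    - apply: reducible_rot; apply: reducible_rot; apply: two => /=; last 2 first.
      + by move: N0; rewrite /mtr; lia.
      + by lia.
      + exact/odd_form_rot/odd_form_rot.
      + by rewrite !mdet_rot.
      + exact/conorms_small_rot/conorms_small_rot.
  move=> oM dM sM.
  have [X0|X0] : 0 < m11 M \/ m11 M < 0.
    by move: oM; mat_unfold => /and3P[? ? ?]; lia.
  - exact: two'.
  - apply: reducible_opp; apply: two' => /=; last by lia.
    + exact: odd_form_opp.
    + by rewrite mdet_opp.
    + exact: conorms_small_opp.
split=> //.
have neg M : odd_form M -> 0 < mdet M -> pos_mat M -> conorms_gt (- b%:Z) M ->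
    conorm2 M < 0 -> reducible M.
  wlog t0 : M / 0 < m11 M - m22 M + m21 M - m12 M.
    move=> wl oM dM pM cM n2.
    have [t0|t0] : 0 < m11 M - m22 M + m21 M - m12 M \/
        0 < m22 M - m11 M + m12 M - m21 M.
      by move: oM; mat_unfold => /and3P[? ? ?]; lia.
    - exact: wl.
    - apply: reducible_mrefl; apply: wl => //.
      + exact: odd_form_mrefl.
      + by rewrite mdet_mrefl.
      + by move: pM; mat_unfold => -[? ? ?]; split; lia.
      + by move: cM; mat_unfold => -[? ? ?]; split; lia.
      + by move: n2; mat_unfold; lia.
  move=> oM dM pM cM n2.
  have [A EA] : exists A : nat, conorm2 M = - A%:Z by exists `|conorm2 M|%N; lia.
  have Ab : (A < b)%N by move: cM; rewrite /conorms_gt => -[? ? ?]; lia.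
  have A0 : 0 < A%:Z by lia.
  have [M2 g12 h] := pos_step oM pM EA A0 t0.
  have oM2 := gamma2_odd g12 oM.
  have dM2 : 0 < mdet M2 by rewrite (gamma2_det g12).
  apply: reducible_step g12 _; have [IH1 _] := IH A Ab.
  case: h => [[p c]|c]; first exact: IH1.
  apply: small => //.
  by move: c; rewrite /conorms_small /conorms_gt => -[[? ? ?] [? ? ?]]; do !split; lia.
move=> M oM dM pM cM.
have [n2|n2] : conorm2 M < 0 \/ 0 < conorm2 M.
  by move: oM; mat_unfold => /and3P[? ? ?]; lia.
  exact: neg.
have [n3|n3] : conorm3 M < 0 \/ 0 < conorm3 M.
  by move: oM; mat_unfold => /and3P[? ? ?]; lia.
  apply: reducible_rot; apply: neg.
  - exact: odd_form_rot.
  - by rewrite mdet_rot.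
  - by move: pM; mat_unfold => -[? ? ?]; split; lia.
  - by move: cM; mat_unfold => -[? ? ?]; split; lia.
  - by move: n3; mat_unfold; lia.
have [n1|n1] : conorm1 M < 0 \/ 0 < conorm1 M.
  by move: oM; mat_unfold => /and3P[? ? ?]; lia.
  apply: reducible_rot; apply: reducible_rot; apply: neg.
  - exact/odd_form_rot/odd_form_rot.
  - by rewrite !mdet_rot.
  - by move: pM; mat_unfold => -[? ? ?]; split; lia.
  - by move: cM; mat_unfold => -[? ? ?]; split; lia.
  - by move: n1; mat_unfold; lia.
by exists M; [exact: gamma2_refl | split].
Qed.

Lemma odd_form_reducible M : odd_form M -> 0 < mdet M -> reducible M.
Proof.
move=> oM dM.
pose b := (`|conorm1 M| + `|conorm2 M| + `|conorm3 M|).+1%N.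
have [_ h] := reducible_ind b; apply: h => //.
by rewrite /b; mat_unfold; do !split; lia.
Qed.

Lemma sqr_odd_ge1 (x : int) : 0 <= (1 + 2 * x) * (1 + 2 * x) - 1.
Proof.
have -> : (1 + 2 * x) * (1 + 2 * x) - 1 = 4 * (x * (x + 1)) by ring.
have [h|h] := leP 0 x; first by nia.
have : 0 <= - x * (- x - 1) by apply: mulr_ge0; lia.
by lia.
Qed.

(* Up to the factor 1/2, [conorm1 x^2 + conorm2 (x + y)^2 + conorm3 y^2] is the
   value at [(x, y)] of the quadratic form of [M]; the two identities compare its
   values at the rows of [g] with those at the unit vectors, which are
   the smallest ones among vectors of the same parity. *)
Lemma obtuse_gamma2_ineq a b c d M :
    (1 + 2 * a) * (1 + 2 * d) - (2 * b) * (2 * c) = 1 -> obtuse M ->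
  let M' := gact (1 + 2 * a) (2 * b) (2 * c) (1 + 2 * d) M in
  0 <= (a - d + 2 * b) * conorm2 M' + (a - d) * conorm1 M' /\
  (a - d - 2 * c) * conorm2 M' + (a - d) * conorm3 M' <= 0.
Proof.
move=> det1 [h1 h2 h3] /=.
have E1 : 2 * ((a - d + 2 * b) * conorm2 (gact (1 + 2 * a) (2 * b) (2 * c) (1 + 2 * d) M) +
    (a - d) * conorm1 (gact (1 + 2 * a) (2 * b) (2 * c) (1 + 2 * d) M)) =
    conorm1 M * ((1 + 2 * a) * (1 + 2 * a) - 1) +
    conorm2 M * ((1 + 2 * (a + b)) * (1 + 2 * (a + b)) - 1) +
    conorm3 M * ((2 * b) * (2 * b)) +
    2 * m11 M * (1 - ((1 + 2 * a) * (1 + 2 * d) - (2 * b) * (2 * c))).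
  by case: (M) => X u v Z; rewrite /conorm1 /conorm2 /conorm3 /gact /=; ring.
have E2 : 2 * ((a - d - 2 * c) * conorm2 (gact (1 + 2 * a) (2 * b) (2 * c) (1 + 2 * d) M) +
    (a - d) * conorm3 (gact (1 + 2 * a) (2 * b) (2 * c) (1 + 2 * d) M)) =
    - (conorm1 M * ((2 * c) * (2 * c)) +
    conorm2 M * ((1 + 2 * (c + d)) * (1 + 2 * (c + d)) - 1) +
    conorm3 M * ((1 + 2 * d) * (1 + 2 * d) - 1)) -
    2 * m22 M * (1 - ((1 + 2 * a) * (1 + 2 * d) - (2 * b) * (2 * c))).
  by case: (M) => X u v Z; rewrite /conorm1 /conorm2 /conorm3 /gact /=; ring.
rewrite det1 subrr mulr0 addr0 in E1; rewrite det1 subrr mulr0 subr0 in E2.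
split; rewrite -(pmulr_rge0 _ (ltr0n int 2)) || rewrite -(pmulr_rle0 _ (ltr0n int 2)).
- rewrite E1 !addr_ge0 //; apply: mulr_ge0; rewrite ?(ltW h1) ?(ltW h2) ?(ltW h3) ?sqr_odd_ge1 //.
  exact: sqr_ge0.
- rewrite E2 oppr_le0 !addr_ge0 //; apply: mulr_ge0;
    rewrite ?(ltW h1) ?(ltW h2) ?(ltW h3) ?sqr_odd_ge1 //; exact: sqr_ge0.
Qed.

(** The determinant equals [(1 + a + d)^2 - (a - d)^2 - 4 b c], and the inequalities give
    [(a - d)^2 < - 4 b c]. Hence the trace [2 (1 + a + d)] is zero, and then the determinant
    equation fails modulo 4: Gamma(2) has no element of order 4. *)
Lemma gamma2_elliptic_absurd (a b c d : int) :
    (1 + 2 * a) * (1 + 2 * d) - (2 * b) * (2 * c) = 1 ->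
  0 < a - d -> a - d + 2 * b < 0 -> a - d - 2 * c < 0 -> False.
Proof.
move=> det1 h1 h2 h3.
have k1 : (a - d) * (a - d) < (- (2 * b)) * (2 * c).
  by apply: ltr_pM => //; lia.
have k2 : (1 + a + d) * (1 + a + d) < 1 by lia.
have k3 : 1 + a + d = 0 by nia.
have Ed : d = - 1 - a by lia.
have : (1 + 2 * a) * (1 + 2 * a) + 1 + 4 * (b * c) = 0 by rewrite Ed in det1; lia.
have -> : (1 + 2 * a) * (1 + 2 * a) + 1 = 4 * (a * a + a) + 2 by ring.
by lia.
Qed.

(** The inequalities are applied to [g] and to its inverse. If [a - d] is nonzero, they force the
    signs excluded by [gamma2_elliptic_absurd]; if [a = d], they give [b = c = 0], so [g] is 1 or
    -1, and -1 would reverse the sign of [conorm2]. *)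
Lemma obtuse_unique M M' : obtuse M -> obtuse M' -> gamma2 M M' -> M = M'.
Proof.
move=> oM oM' gM; case: (gM) => [a [b [c [d [det1 EM']]]]].
have [i1 i2] := obtuse_gamma2_ineq det1 oM; rewrite -EM' in i1 i2.
have det1' : (1 + 2 * d) * (1 + 2 * a) - (2 * (- b)) * (2 * (- c)) = 1.
  by rewrite -[RHS]det1; ring.
have [j1 j2] := obtuse_gamma2_ineq det1' oM'.
have EM : gact (1 + 2 * d) (2 * (- b)) (2 * (- c)) (1 + 2 * a) M' = M.
  rewrite EM'; case: (M) => X u v Z; rewrite /gact /=; congr Mat.
  - by rewrite -[RHS]mul1r -[Y in _ = Y * _]det1; ring.
  - by rewrite -[RHS]mul1r -[Y in _ = Y * _]det1; ring.
  - by rewrite -[RHS]mul1r -[Y in _ = Y * _]det1; ring.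
  - by rewrite -[RHS]mul1r -[Y in _ = Y * _]det1; ring.
rewrite EM in j1 j2.
case: (oM) (oM') => [h1 h2 h3] [k1 k2 k3].
have [hA|hA|hA] := ltgtP 0 (a - d).
- case: (gamma2_elliptic_absurd det1 hA); rewrite ltNge; apply/negP => h.
  + have := mulr_ge0 h (ltW h2); have := mulr_gt0 hA h1; lia.
  + have := mulr_ge0 h (ltW k2); have := mulr_gt0 hA k3; lia.
- have hA' : 0 < d - a by lia.
  case: (gamma2_elliptic_absurd det1' hA'); rewrite ltNge; apply/negP => h.
  + have := mulr_ge0 h (ltW k2); have := mulr_gt0 hA' k1; lia.
  + have := mulr_ge0 h (ltW h2); have := mulr_gt0 hA' h3; lia.
have Ed : d = a by lia.
have b0 : b = 0 by rewrite Ed in i1 j1; nia.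
have c0 : c = 0 by rewrite Ed in i2 j2; nia.
have [Ea|Ea] : a = 0 \/ a = -1 by rewrite Ed b0 in det1; nia.
- rewrite EM' Ed b0 c0 Ea; case: (M) => X u v Z; rewrite /gact /=; congr Mat; ring.
- move: k2; rewrite EM' Ed b0 c0 Ea /conorm2 /=.
  by move: h2; rewrite /conorm2; lia.
Qed.

(** Compares cardinalities along a total injective relation. Normal forms are only known to exist,
    and this avoids choosing a function that returns them. *)
Lemma leq_card_rel (T1 T2 : finType) (A : {set T1}) (B : {set T2})
    (rel : T1 -> T2 -> Prop) :
    (forall a, a \in A -> exists2 b, b \in B & rel a b) ->
    (forall a a' b, a \in A -> a' \in A -> rel a b -> rel a' b -> a = a') ->
  (#|A| <= #|B|)%N.
Proof.
move: {2}#|A| (erefl #|A|) => n; elim: n A B => [|n IH] A B cA tot inj.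
  by rewrite cA.
have /card_gt0P[a aA] : (0 < #|A|)%N by rewrite cA.
have [b bB rab] := tot a aA.
rewrite (cardsD1 a) aA (cardsD1 b B) bB leq_add2l; apply: IH.
- by move: cA; rewrite (cardsD1 a) aA => -[].
- move=> a' /setD1P[na' a'A]; have [b' b'B ra'b'] := tot a' a'A.
  exists b' => //; apply/setD1P; split=> //; apply: contra_neq na' => Eb'.
  by rewrite Eb' in ra'b'; exact: inj a'A aA ra'b' rab.
- by move=> x y z /setD1P[_ xA] /setD1P[_ yA]; exact: inj.
Qed.

(** * Hermite normal forms under Gamma(2), and the count of orbits *)

Lemma gamma2_m12_even M M' :
  gamma2 M M' -> (m12 M %% 2)%Z = 0 -> (m12 M' %% 2)%Z = 0.
Proof.
move=> [a [b [c [d [_ ->]]]]] /=.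
have -> : (1 + 2 * a) * m12 M + 2 * b * m22 M = m12 M + 2 * (a * m12 M + b * m22 M) by ring.
by move: (a * m12 M + b * m22 M) => x; lia.
Qed.

(** The Euclidean algorithm on the second column with even multipliers. One entry is even and the
    other odd, so their absolute values always differ and the larger can be decreased; the process
    ends with the even entry zero. Then the odd entry [m21] is reduced modulo [2 m11]. *)
Lemma hermite_exists M : odd_form M -> (m12 M %% 2)%Z = 0 -> 0 < mdet M ->
  exists X v Z : int, [/\ 0 < X, 0 < Z, 0 < v < 2 * X, oddz v & gamma2 M (Mat X 0 v Z)].
Proof.
move: {2}(`|m12 M| + `|m22 M|)%N (leqnn (`|m12 M| + `|m22 M|)%N) => n.
elim: n M => [|n IH] M hn oM eM dM.
  by move: oM; mat_unfold => /and3P[? ? ?]; lia.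
have next M' : gamma2 M M' -> (`|m12 M'| + `|m22 M'| <= n)%N ->
    exists X v Z : int, [/\ 0 < X, 0 < Z, 0 < v < 2 * X, oddz v & gamma2 M (Mat X 0 v Z)].
  move=> g hn'; have [||||X [v [Z [h1 h2 h3 h4 h5]]]] := IH M'.
  - exact: hn'.
  - exact: gamma2_odd g oM.
  - exact: gamma2_m12_even g eM.
  - by rewrite (gamma2_det g).
  - by exists X, v, Z; split=> //; exact: gamma2_trans g h5.
have [u0|u0] := eqVneq (m12 M) 0.
  wlog Z0 : M oM eM dM u0 {hn next} / 0 < m22 M.
    move=> wl; have [Z0|Z0] : 0 < m22 M \/ m22 M < 0.
      by move: oM; mat_unfold => /and3P[? ? ?]; lia.
    - exact: wl.
    - have [|||||X [v [Z [h1 h2 h3 h4 h5]]]] := wl (mopp M).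
      + exact: odd_form_opp.
      + by rewrite /=; lia.
      + by rewrite mdet_opp.
      + by rewrite /= u0.
      + by rewrite /=; lia.
      + exists X, v, Z; split=> //; exact: gamma2_trans (gamma2_opp M) h5.
  have X0 : 0 < m11 M by move: dM; rewrite /mdet u0 mul0r subr0 pmulr_lgt0.
  set j := ((m21 M) %/ (2 * m11 M))%Z.
  exists (m11 M), (m21 M + 2 * (- j) * m11 M), (m22 M).
  have jE : m21 M = j * (2 * m11 M) + (m21 M %% (2 * m11 M))%Z by exact: divz_eq.
  have m0 : 0 <= (m21 M %% (2 * m11 M))%Z by apply: modz_ge0; lia.
  have m1 : (m21 M %% (2 * m11 M))%Z < 2 * m11 M by apply: ltz_pmod; lia.
  have Ev : m21 M + 2 * (- j) * m11 M = (m21 M %% (2 * m11 M))%Z by rewrite {1}jE; ring.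
  have ov : oddz (m21 M + 2 * (- j) * m11 M).
    rewrite /oddz -mulrA; move: (- j * m11 M) => x.
    by move: oM; mat_unfold => /and3P[? ? ?]; lia.
  split=> //.
    apply/andP; split; last by rewrite Ev.
    by rewrite Ev lt_neqAle m0 andbT; apply: contraTneq ov; rewrite Ev => <-.
  exists 0, 0, (- j), 0; split; first by ring.
  by rewrite /gact u0; congr Mat; ring.
have [uZ|uZ] : (`|m12 M| < `|m22 M|)%N \/ (`|m22 M| < `|m12 M|)%N.
  by move: oM; mat_unfold => /and3P[? ? ?]; lia.
- have [s Es hs] : exists2 s : int, `|s| = 1 & `|m22 M + 2 * s * m12 M| < `|m22 M|.
    have [h|h] : 0 < m12 M * m22 M \/ m12 M * m22 M < 0 by nia.
    + by exists (-1) => //; have [h'|h'] := ltP 0 (m22 M); nia.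
    + by exists 1 => //; have [h'|h'] := ltP 0 (m22 M); nia.
  apply: (next (gact 1 0 (2 * s) 1 M)).
    by exists 0, 0, s, 0; split; [ring | congr gact; ring].
  by rewrite /=; move: hs hn; rewrite mul0r addr0 mul1r addrC mul1r; lia.
- have [s Es hs] : exists2 s : int, `|s| = 1 & `|m12 M + 2 * s * m22 M| < `|m12 M|.
    have [h|h] : 0 < m12 M * m22 M \/ m12 M * m22 M < 0.
      by move: oM; mat_unfold => /and3P[? ? ?]; nia.
    + by exists (-1) => //; have [h'|h'] := ltP 0 (m22 M); nia.
    + by exists 1 => //; have [h'|h'] := ltP 0 (m22 M); nia.
  apply: (next (gact 1 (2 * s) 0 1 M)).
    by exists 0, s, 0, 0; split; [ring | congr gact; ring].
  by rewrite /=; move: hs hn; rewrite mul0r add0r !mul1r; lia.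
Qed.

Lemma hermite_unique X v Z X' v' Z' : 0 < X -> 0 < Z -> 0 < Z' ->
    0 < v < 2 * X -> 0 < v' < 2 * X' -> gamma2 (Mat X 0 v Z) (Mat X' 0 v' Z') ->
  [/\ X = X', v = v' & Z = Z'].
Proof.
move=> X0 Z0 Z'0 hv hv' [a [b [c [d [det1]]]]]; rewrite /gact /= => -[EX Eu Ev EZ].
have b0 : b = 0 by nia.
rewrite b0 in det1 EX Eu EZ.
have dE : (1 + 2 * a) * (1 + 2 * d) = 1 by rewrite -[RHS]det1; ring.
have a0 : 0 < 1 + 2 * a.
  by rewrite -(pmulr_lgt0 _ X0); lia.
have d0 : 0 < 1 + 2 * d by rewrite -(pmulr_rgt0 _ a0) dE.
have Ea : a = 0 by nia.
have Ed : d = 0 by nia.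
rewrite Ea in EX; rewrite Ed in EZ Ev.
have EX' : X' = X by lia.
split; [by lia| |by lia].
rewrite EX' in hv'.
have [c1|c1|c0] := ltgtP c 0.
- have : c * X <= - X by nia.
  by lia.
- have : X <= c * X by nia.
  by lia.
- by rewrite Ev c0; ring.
Qed.

(* [x], [y], [z] become the conorms and [w] the difference of the off-diagonal
   entries; its sign is chosen to make [m12] even. *)
Definition mat_of_sol (w x y z : nat) : mat :=
  let w' : int := if (w == y %[mod 4])%N then w%:Z else - w%:Z in
  Mat (((x + y) %/ 2)%N : int) ((y%:Z - w') %/ 2)%Z ((y%:Z + w') %/ 2)%Z (((y + z) %/ 2)%N : int).

Definition is_sol (k w x y z : nat) :=
  [&& odd w, odd x, x == y %[mod 4], y == z %[mod 4] &
      w * w + (x * y + y * z + z * x) == 4 * k]%N.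

(** The determinant comes from [4 det M = w^2 + x y + y z + z x], where [x], [y], [z] are the
    conorms and [w] is the difference of the off-diagonal entries. The congruences modulo 4 say that
    the diagonal entries are odd. *)
Lemma mat_of_solP k w x y z : is_sol k w x y z ->
  let M := mat_of_sol w x y z in
  [/\ odd_form M, (m12 M %% 2)%Z = 0, mdet M = k &
    [/\ conorm1 M = x, conorm2 M = y, conorm3 M = z & `|m21 M - m12 M|%N = w]].
Proof.
move=> /and5P[ow ox /eqP xy /eqP yz /eqP E] /=.
rewrite /mat_of_sol.
set w' : int := if _ then _ else _.
have ww : `|w'|%N = w by rewrite /w'; case: ifP; lia.
have w4 : ((y%:Z - w') %% 4)%Z = 0 by rewrite /w'; case: ifP; lia.
have Ey : y%:Z = w' + 2 * ((y%:Z - w') %/ 2)%Z by lia.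
have Ey2 : y%:Z = - w' + 2 * ((y%:Z + w') %/ 2)%Z by lia.
have Ex : x%:Z + y%:Z = 2 * ((x + y) %/ 2)%N%:Z by lia.
have Ez : y%:Z + z%:Z = 2 * ((y + z) %/ 2)%N%:Z by lia.
have E' : w' * w' + (x%:Z * y + y%:Z * z + z%:Z * x) = 4 * k%:Z.
  have -> : w' * w' = w%:Z * w by rewrite /w'; case: ifP => _; ring.
  by lia.
split; mat_unfold.
- by apply/and3P; split; lia.
- by lia.
- move: Ey Ey2 Ex Ez E'.
  move: ((y%:Z - w') %/ 2)%Z ((y%:Z + w') %/ 2)%Z (((x + y) %/ 2)%N%:Z) (((y + z) %/ 2)%N%:Z).
  move=> u v X Z Ey Ey2 Ex Ez E'.
  have yE : y%:Z = u + v by lia.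
  have wE : w' = v - u by lia.
  have xE : x%:Z = 2 * X - u - v by lia.
  have zE : z%:Z = 2 * Z - u - v by lia.
  by move: E'; rewrite xE zE yE wE; lia.
- by split; lia.
Qed.

Lemma mat_of_sol_surj (k : nat) M : odd_form M -> (m12 M %% 2)%Z = 0 -> mdet M = k ->
    obtuse M ->
  exists w x y z, is_sol k w x y z /\ mat_of_sol w x y z = M.
Proof.
case: M => X u v Z; mat_unfold => /and3P[h1 h2 h3] u2 dM [o1 o2 o3].
have [x Ex] : exists x : nat, x%:Z = 2 * X - u - v by exists (absz (2 * X - u - v)%R); lia.
have [y Ey] : exists y : nat, y%:Z = u + v by exists (absz (u + v)%R); lia.
have [z Ez] : exists z : nat, z%:Z = 2 * Z - u - v by exists (absz (2 * Z - u - v)%R); lia.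
have [w Ew] : exists w : nat, w%:Z = v - u \/ w%:Z = u - v.
  by exists (absz (v - u)%R); lia.
have E0 : w%:Z * w%:Z + (x%:Z * y%:Z + y%:Z * z%:Z + z%:Z * x%:Z) = 4 * k%:Z.
  rewrite Ex Ey Ez -dM; case: Ew => ->; ring.
exists w, x, y, z; split.
  by rewrite /is_sol; apply/and5P; split; lia.
rewrite /mat_of_sol.
set w' : int := if _ then _ else _.
have -> : w' = v - u by rewrite /w'; case: ifP; lia.
by congr Mat; lia.
Qed.

Lemma is_sol_le k w x y z : is_sol k w x y z ->
  [/\ w <= 4 * k, x <= 4 * k, y <= 4 * k & z <= 4 * k]%N.
Proof.
move=> /and5P[ow ox /eqP xy /eqP yz /eqP <-].
have w0 : (0 < w)%N by lia.
have x0 : (0 < x)%N by lia.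
have y0 : (0 < y)%N by lia.
have z0 : (0 < z)%N by lia.
have := leq_pmulr w w0; have := leq_pmulr x y0; have := leq_pmulr y z0.
have := leq_pmulr z x0; move: (w * w)%N (x * y)%N (y * z)%N (z * x)%N => a b c d.
by split; lia.
Qed.

(** Both sets represent each Gamma(2)-orbit of odd forms with determinant [k] and even [m12] exactly
    once: the first by obtuse matrices, the second by Hermite forms. The second set has [sigma(k)]
    elements, since each divisor [X] admits [X] odd values below [2 X]. *)
Lemma card_sol (N k : nat) : odd k -> (4 * k < N)%N ->
  #|[set t : 'I_N * 'I_N * ('I_N * 'I_N) | is_sol k t.1.1 t.1.2 t.2.1 t.2.2]| =
  #|[set t : 'I_N * 'I_N * 'I_N |
      [&& t.1.1 * t.1.2 == k, odd t.2 & t.2 < 2 * t.1.1]%N]|.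
Proof.
move=> ok kN.
pose rel (t : 'I_N * 'I_N * ('I_N * 'I_N)) (s : 'I_N * 'I_N * 'I_N) :=
  gamma2 (mat_of_sol t.1.1 t.1.2 t.2.1 t.2.2) (Mat s.1.1 0 s.2 s.1.2).
apply/eqP; rewrite eqn_leq; apply/andP; split.
- apply: (@leq_card_rel _ _ _ _ rel).
  + move=> [[w x] [y z]]; rewrite inE /= => tP.
    have [oM eM dM [c1 c2 c3 _]] := mat_of_solP tP.
    have [|X [v [Z [X0 Z0 hv ov gM]]]] := hermite_exists oM eM.
      by rewrite dM; lia.
    have XZ : X * Z = k.
      by move: (gamma2_det gM); rewrite dM /mdet /= mul0r subr0.
    have Xk : X <= k%:Z by nia.
    have Zk : Z <= k%:Z by nia.
    have [X' EX] : exists X' : nat, X = X' by exists (absz X); lia.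
    have [Z' EZ] : exists Z' : nat, Z = Z' by exists (absz Z); lia.
    have [v' Ev] : exists v' : nat, v = v' by exists (absz v); lia.
    have X'N : (X' < N)%N by lia.
    have Z'N : (Z' < N)%N by lia.
    have v'N : (v' < N)%N by lia.
    exists (Ordinal X'N, Ordinal Z'N, Ordinal v'N).
      rewrite inE /=; apply/and3P; split; first by lia.
        by move: ov; rewrite /oddz; lia.
      by lia.
    by rewrite /rel /= -EX -EZ -Ev.
  + move=> [[w x] [y z]] [[w' x'] [y' z']] s; rewrite !inE /= => tP tP' r r'.
    have [_ _ _ [c1 c2 c3 c4]] := mat_of_solP tP.
    have [_ _ _ [c1' c2' c3' c4']] := mat_of_solP tP'.
    have E : mat_of_sol w x y z = mat_of_sol w' x' y' z'.
      apply: obtuse_unique.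
      * by split; rewrite ?c1 ?c2 ?c3; move/and5P: tP => [? ? ? ? ?]; lia.
      * by split; rewrite ?c1' ?c2' ?c3'; move/and5P: tP' => [? ? ? ? ?]; lia.
      * exact: gamma2_trans r (gamma2_sym r').
    rewrite E in c1 c2 c3 c4.
    have Ew : w = w' by apply/val_inj; rewrite /= -c4 c4'.
    have Ex : x = x' by apply/val_inj => /=; lia.
    have Ey : y = y' by apply/val_inj => /=; lia.
    have Ez : z = z' by apply/val_inj => /=; lia.
    by rewrite Ew Ex Ey Ez.
- apply: (@leq_card_rel _ _ _ _ (fun s t => rel t s)).
  + move=> [[X Z] v]; rewrite inE /= => /and3P[/eqP XZ ov vX].
    have oM : odd_form (Mat X 0 v Z).
      by move: ok; rewrite -XZ oddM /odd_form /oddz => /andP[? ?]; apply/and3P; split; rewrite /=; lia.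
    have dM : mdet (Mat X 0 v Z) = k by rewrite /mdet /= mul0r subr0 -XZ PoszM.
    have [|M' gM oM'] := odd_form_reducible oM; first by rewrite dM; lia.
    have [|||w [x [y [z [tP EM]]]]] := @mat_of_sol_surj k M' _ _ _ oM'.
    * exact: gamma2_odd gM oM.
    * exact: gamma2_m12_even gM _.
    * by rewrite (gamma2_det gM).
    have [wk xk yk zk] := is_sol_le tP.
    have wN := leq_ltn_trans wk kN; have xN := leq_ltn_trans xk kN.
    have yN := leq_ltn_trans yk kN; have zN := leq_ltn_trans zk kN.
    exists ((Ordinal wN, Ordinal xN), (Ordinal yN, Ordinal zN)); first by rewrite inE.
    by rewrite /rel /= EM; exact: gamma2_sym.
  + move=> [[X Z] v] [[X' Z'] v'] t.
    rewrite !inE /= => /and3P[/eqP XZ ov vX] /and3P[/eqP XZ' ov' vX'] r r'.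
    have [||||||EX Ev EZ] := @hermite_unique X v Z X' v' Z'.
    * by have := odd_gt0 ok; rewrite -XZ muln_gt0 => /andP[].
    * by have := odd_gt0 ok; rewrite -XZ muln_gt0 => /andP[].
    * by have := odd_gt0 ok; rewrite -XZ' muln_gt0 => /andP[].
    * by apply/andP; split; lia.
    * by apply/andP; split; lia.
    * exact: gamma2_trans (gamma2_sym r) r'.
    congr (_, _, _); apply/val_inj => /=; lia.
Qed.

(** * Three odd squares *)

Lemma sum_involution (T : finType) (P : pred T) (F G : T -> int) (h : T -> T) :
    (forall t, P t -> P (h t)) -> (forall t, P t -> h (h t) = t) ->
    (forall t, P t -> F (h t) = G t) ->
  \sum_(t | P t) F t = \sum_(t | P t) G t.
Proof.
move=> hP hK hF; rewrite (reindex_onto h h) //=.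
rewrite (eq_bigl P) => [|t]; first exact: eq_bigr.
apply/andP/idP => [[Pht /eqP <-]|Pt]; first exact: hP.
by rewrite hP // hK.
Qed.

Lemma sum_antisym (T : finType) (P : pred T) (F : T -> int) (h : T -> T) :
    (forall t, P t -> P (h t)) -> (forall t, P t -> h (h t) = t) ->
    (forall t, P t -> F (h t) = - F t) ->
  \sum_(t | P t) F t = 0.
Proof.
move=> hP hK hF; have := sum_involution hP hK hF; rewrite sumrN.
by move: (\sum_(t | P t) F t) => s; lia.
Qed.

(** For [m = 4 k] with [k] odd and [k <= N] this is the divisor sum [sigma(k)]. *)
Definition odd_divisor_sum (N m : nat) : int :=
  \sum_(p : 'I_N.+1 * 'I_N.+1 | [&& odd p.1, odd p.2 & 4 * (p.1 * p.2) == m]%N) (p.1 : nat)%:Z.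

Section DivisorRecursion.

Variables (N n : nat).
Hypothesis nN : (n <= N)%N.

(** Triples [(w, d, e)] with [w^2 + 4 d e = n] and [w] signed: the boolean is the sign of [w]. As
    [w] is odd, it is nonzero and the encoding is faithful. *)
Local Notation T := (bool * 'I_N.+1 * ('I_N.+1 * 'I_N.+1))%type.

Let sw (t : T) : int := if t.1.1 then - (t.1.2 : nat)%:Z else (t.1.2 : nat)%:Z.
Let dl (t : T) : int := (t.2.1 : nat)%:Z.
Let dr (t : T) : int := (t.2.2 : nat)%:Z.

Let Pt (t : T) := [&& odd t.1.2, odd t.2.1, odd t.2.2 &
  t.1.2 * t.1.2 + 4 * (t.2.1 * t.2.2) == n]%N.

Let Qt (w d e : int) := [/\ oddz w, oddz d, oddz e & [/\ 0 < d, 0 < e & w * w + 4 * (d * e) = n]].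

Let enc (w d e : int) : T := ((w < 0, inord (absz w)), (inord (absz d), inord (absz e))).

Let PtQ t : Pt t -> Qt (sw t) (dl t) (dr t).
Proof.
move=> /and4P[ow od oe /eqP E]; rewrite /Qt /sw /dl /dr /oddz.
have E' : (t.1.2 : nat)%:Z * (t.1.2 : nat)%:Z + 4 * ((t.2.1 : nat)%:Z * (t.2.2 : nat)%:Z) = n%:Z by lia.
by split; [case: ifP; lia | lia | lia | split; [lia | lia | case: ifP => _; lia]].
Qed.

Let encK t : Pt t -> enc (sw t) (dl t) (dr t) = t.
Proof.
case: t => [[b w] [d e]] /and4P[/= ow od oe /eqP E]; rewrite /enc /sw /dl /dr /=.
congr (_, _, (_, _)); rewrite ?absz_nat ?inord_val //.
- by case: b; lia.
- by apply: val_inj; case: b; rewrite /= inordK ?abszN ?absz_nat.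
Qed.

Let QtP w d e : Qt w d e -> [/\ Pt (enc w d e), sw (enc w d e) = w, dl (enc w d e) = d
  & dr (enc w d e) = e].
Proof.
move=> [ow od oe [d0 e0 E]].
have bw : (absz w <= n)%N by nia.
have bd : (absz d <= n)%N by nia.
have be : (absz e <= n)%N by nia.
have Ew : (inord (absz w) : 'I_N.+1) = absz w :> nat by rewrite inordK //; lia.
have Ed : (inord (absz d) : 'I_N.+1) = absz d :> nat by rewrite inordK //; lia.
have Ee : (inord (absz e) : 'I_N.+1) = absz e :> nat by rewrite inordK //; lia.
rewrite /sw /dl /dr /Pt /enc /= Ew Ed Ee; split.
- apply/and4P; move: ow od oe; rewrite /oddz => ow od oe; split; try lia.
- by case: ifP; lia.
- by lia.
- by lia.
Qed.

(** An involution in the style of Liouville and Zagier that preserves [w^2 + 4 d e]. The case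
    [w + d = e] cannot occur, by parity, and each branch maps into itself. Up to one sign it
    permutes the three factors [d + e], [d + w], [e - w], so their product is antisymmetric. *)
Let hstep (t : T) : T :=
  if sw t + dl t > dr t then enc (2 * dr t - sw t) (dl t - dr t + sw t) (dr t)
  else enc (- sw t - 2 * dl t) (dl t) (dr t - dl t - sw t).

Lemma sum_divisor_antisym :
  \sum_(t | Pt t) (dl t + dr t) * (dl t + sw t) * (dr t - sw t) = 0.
Proof.
have hQ t : Pt t -> sw t + dl t > dr t -> Qt (2 * dr t - sw t) (dl t - dr t + sw t) (dr t).
  move=> /PtQ; rewrite /Qt /oddz => -[ow od oe [d0 e0 E]] h.
  by split; [lia | lia | lia | split; [lia | lia | rewrite -E; ring]].
have hQ' t : Pt t -> sw t + dl t <= dr t -> Qt (- sw t - 2 * dl t) (dl t) (dr t - dl t - sw t).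
  move=> /PtQ; rewrite /Qt /oddz => -[ow od oe [d0 e0 E]] h.
  by split; [lia | lia | lia | split; [lia | lia | rewrite -E; ring]].
apply: (sum_antisym (h := hstep)) => t tP; rewrite /hstep.
- by case: ltP => h; [case: (QtP (hQ t tP h)) | case: (QtP (hQ' t tP h))].
- have [_ _ _ [d0 e0 _]] := PtQ tP.
  have [h|h] := ltP (dr t) (sw t + dl t);
    [case: (QtP (hQ t tP h)) | case: (QtP (hQ' t tP h))] => _ -> -> ->.
  + case: ltP => h'; last by lia.
    by rewrite -[RHS]encK //; congr enc; ring.
  + case: ltP => h'; first by lia.
    by rewrite -[RHS]encK //; congr enc; ring.
- case: ltP => h; [case: (QtP (hQ t tP h)) | case: (QtP (hQ' t tP h))] => _ -> -> ->; ring.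
Qed.

(** The antisymmetric product expands as [(d + e) (d e - w^2) + (d + e) (e - d) w]. The second term
    cancels under [w -> - w], and exchanging [d] and [e] makes the two halves of the first term
    equal. *)
Lemma sum_divisor_weighted :
  \sum_(t | Pt t) (dl t) * (dl t * dr t - sw t * sw t) = 0.
Proof.
have swap (F G : T -> int) : (forall t, Pt t -> F (t.1, (t.2.2, t.2.1)) = G t) ->
    \sum_(t | Pt t) F t = \sum_(t | Pt t) G t.
  move=> h; apply: (sum_involution (h := fun t : T => (t.1, (t.2.2, t.2.1)))) => //.
  + by move=> t /and4P[? ? ? ?]; apply/and4P; split=> //=; rewrite mulnC [(t.2.2 * _)%N]mulnC mulnC.
  + by move=> [[b w] [d e]].
have neg (F : T -> int) : (forall t, Pt t -> F ((~~ t.1.1, t.1.2), t.2) = - F t) ->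
    \sum_(t | Pt t) F t = 0.
  move=> h; apply: (sum_antisym (h := fun t : T => ((~~ t.1.1, t.1.2), t.2))) => //.
  by move=> [[b w] [d e]] _ /=; rewrite negbK.
have := sum_divisor_antisym.
rewrite (eq_bigr (fun t => (dl t * (dl t * dr t - sw t * sw t) +
   dr t * (dl t * dr t - sw t * sw t)) + (dl t + dr t) * (dr t - dl t) * sw t)); last first.
  by move=> t _; ring.
rewrite !big_split /= [X in _ + X = _](neg _); last first.
  by move=> t _; rewrite /sw /dl /dr /=; case: t.1.1 => /=; ring.
rewrite addr0 [X in _ + X = _](swap _ (fun t => dl t * (dl t * dr t - sw t * sw t))).
  by move/eqP; rewrite -mulr2n mulrn_eq0 => /eqP.
by move=> t _; rewrite /sw /dl /dr /=; ring.
Qed.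

(** The weighted sum multiplied by 4: on solutions, [4 (d e - w^2) = n - 5 w^2]. *)
Lemma odd_divisor_sum_rec :
  \sum_(w < N.+1 | odd w && (w * w <= n)%N)
    (n%:Z - 5 * (w * w)%N%:Z) * odd_divisor_sum N (n - w * w) = 0.
Proof.
have := sum_divisor_weighted.
have -> : \sum_(t | Pt t) (dl t) * (dl t * dr t - sw t * sw t) =
   \sum_(bw : bool * 'I_N.+1) \sum_(p : 'I_N.+1 * 'I_N.+1 | Pt (bw, p))
    (dl (bw, p)) * (dl (bw, p) * dr (bw, p) - sw (bw, p) * sw (bw, p)).
  by rewrite pair_big_dep /=; apply: eq_big => [[bw p]|[bw p] _].
pose G (w : 'I_N.+1) := \sum_(p : 'I_N.+1 * 'I_N.+1 | Pt ((false, w), p))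
    ((p.1 : nat)%:Z * ((p.1 : nat)%:Z * (p.2 : nat)%:Z - (w : nat)%:Z * (w : nat)%:Z)).
have -> : \sum_(bw : bool * 'I_N.+1) \sum_(p : 'I_N.+1 * 'I_N.+1 | Pt (bw, p))
    (dl (bw, p)) * (dl (bw, p) * dr (bw, p) - sw (bw, p) * sw (bw, p)) =
  \sum_(b : bool) \sum_(w < N.+1) G w.
  rewrite [RHS]pair_big /=; apply: eq_bigr => -[b w] _.
  by apply: eq_bigr => p _; rewrite /dl /dr /sw /=; case: b; ring.
rewrite big_bool /= => G0.
have {}G0 : \sum_(w < N.+1) G w = 0.
  by move/eqP: G0; rewrite -mulr2n mulrn_eq0 => /eqP.
rewrite big_mkcond -[RHS](mulr0 4) -[X in _ = 4 * X]G0 mulr_sumr.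
apply: eq_bigr => w _; rewrite /G.
case: ifP => [/andP[ow wn]|hw].
  rewrite /odd_divisor_sum mulr_sumr mulr_sumr.
  apply: eq_big => [p|p /and3P[? ? /eqP h]].
    rewrite /Pt /= ow /=; congr [&& _, _ & _].
    by apply/eqP/eqP; lia.
  have En : n = (w * w + 4 * (p.1 * p.2))%N by rewrite h subnKC.
  rewrite {1}En PoszD !PoszM; ring.
rewrite big_pred0 ?mulr0 // => p; rewrite /Pt /=.
by apply/negbTE/negP => /and4P[ow _ _ /eqP E]; move: hw; rewrite ow /=; lia.
Qed.

End DivisorRecursion.

(** * Powers of the truncated theta series of the odd squares *)

Definition odd_theta (N : nat) : {poly int} := \sum_(w < N.+1 | odd w) 'X^(w * w).

Lemma coef_odd_thetaM N (p : {poly int}) n :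
  (odd_theta N * p)`_n = \sum_(w < N.+1 | odd w && (w * w <= n)%N) p`_(n - w * w).
Proof.
rewrite /odd_theta mulr_suml coef_sum big_mkcondr; apply: eq_bigr => w _.
by rewrite coefXnM ltnNge; case: (w * w <= n)%N.
Qed.

(** The coefficient of degree [n] in [X (theta^5)' = 5 (X theta') theta^4], compared with
    [theta^5 = theta theta^4]. *)
Lemma odd_theta4_rec N n :
  \sum_(w < N.+1 | odd w && (w * w <= n)%N)
    (n%:Z - 5 * (w * w)%N%:Z) * (odd_theta N ^+ 4)`_(n - w * w) = 0.
Proof.
have E : 'X * (odd_theta N ^+ 5)^`() =
    5%:P * \sum_(w < N.+1 | odd w) (w * w)%N%:Z *: 'X^(w * w) * odd_theta N ^+ 4.
  rewrite deriv_exp /= {2}/odd_theta raddf_sum -!mulr_suml /=.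
  have -> : \sum_(w < N.+1 | odd w) (w * w)%N%:Z *: 'X^(w * w) =
      'X * \sum_(w < N.+1 | odd w) ('X^(w * w))^`() :> {poly int}.
    rewrite mulr_sumr; apply: eq_bigr => w ow.
    have w0 : (0 < w * w)%N by rewrite muln_gt0; case: (w : nat) ow.
    rewrite derivXn -(prednK w0) /= mulrnAr -exprS -scaler_nat.
    by congr (_ *: _); rewrite natz.
  have -> : 5%:P = 5%:R :> {poly int} by rewrite rmorph_nat.
  by rewrite -/(odd_theta N) mulrnAr -mulr_natl !mulrA.
move/(congr1 (fun p : {poly int} => p`_n)): E.
rewrite coefXM coefCM coef_sum.
have -> : (if n == 0 then 0 else (odd_theta N ^+ 5)^`()`_n.-1) = n%:Z * (odd_theta N ^+ 5)`_n.
  case: n => [|n] /=; first by rewrite mul0r.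
  by rewrite coef_deriv -mulr_natl natz.
rewrite exprS coef_odd_thetaM => E.
under eq_bigr do rewrite mulrBl -mulrA.
rewrite sumrB -!mulr_sumr E; apply/eqP; rewrite subr_eq0; apply/eqP; congr (_ * _).
rewrite [RHS]big_mkcondr; apply: eq_bigr => w _.
by rewrite -scalerAl coefZ coefXnM ltnNge; case: (w * w <= n)%N => //=; rewrite mulr0.
Qed.

Lemma odd_square_mod8 w : odd w -> (w * w %% 8 = 1)%N.
Proof.
move=> ow; have [j ->] : exists j, w = (2 * j).+1 by exists w./2; lia.
have -> : ((2 * j).+1 * (2 * j).+1 = 4 * (j * j.+1) + 1)%N by lia.
have : ~~ odd (j * j.+1) by rewrite oddM /=; case: (odd j).
by move: (j * j.+1)%N => i; lia.
Qed.

(** In the relation at [m + 1] the term [w = 1] involves [x m]. Since odd squares are 1 modulo 8,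
    all other terms involve smaller arguments in the same residue class, where [x] already vanishes.
    The relation says nothing when the coefficient of [x m] is zero, hence the separate base
    hypothesis. *)
Lemma odd_square_rec_unique (M N c : nat) (g : nat -> nat -> int) (x : nat -> int) :
    (M <= N)%N ->
    (forall m, (m %% 8 = c)%N -> (m < M)%N ->
      \sum_(w < N.+1 | odd w && (w * w <= m.+1)%N) g m w * x (m.+1 - w * w)%N = 0) ->
    (forall m, (m %% 8 = c)%N -> (m < M)%N -> g m 1%N = 0 -> x m = 0) ->
  forall m, (m %% 8 = c)%N -> (m < M)%N -> x m = 0.
Proof.
move=> MN xrec xbase; elim/ltn_ind=> m IH mc mN.
have [|g1] := eqVneq (g m 1%N) 0; first exact: xbase.
have N1 : (1 < N.+1)%N by lia.
move: (xrec m mc mN); rewrite (bigD1 (Ordinal N1)) //= big1 => [|w].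
  by rewrite subn1 /= addr0 => /eqP; rewrite mulf_eq0 (negbTE g1) => /eqP.
move=> /andP[/andP[ow wm] w1].
have w8 := odd_square_mod8 ow.
have w3 : (2 < w)%N by move: w1 ow; rewrite -val_eqE /=; case: (w : nat) => [|[|[]]].
have ww : (8 < w * w)%N by exact: (@leq_mul 3 3).
by rewrite IH ?mulr0 //; move: (w * w)%N w8 wm ww => i; lia.
Qed.

Lemma odd_theta_small N n (p : {poly int}) : (0 < N)%N -> (0 < n < 9)%N ->
  (odd_theta N * p)`_n = p`_n.-1.
Proof.
move=> N0 n9; have N1 : (1 < N.+1)%N by lia.
rewrite coef_odd_thetaM (bigD1 (Ordinal N1)) /=; last by lia.
rewrite big1 => [|w]; first by rewrite addr0 subn1.
move=> /andP[/andP[ow wn]]; rewrite -val_eqE /= => w1.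
have w3 : (2 < w)%N by move: w1 ow; case: (w : nat) => [|[|[]]].
by have := @leq_mul 3 3 w w w3 w3; lia.
Qed.

Lemma odd_divisor_sum4 N : (0 < N)%N -> odd_divisor_sum N 4 = 1.
Proof.
move=> N0; have N1 : (1 < N.+1)%N by lia.
rewrite /odd_divisor_sum (bigD1 (Ordinal N1, Ordinal N1)) //= big1 ?addr0 //.
move=> [d e] /andP[/and3P[/= od oe /eqP h]]; case/negP.
have : (d * e = 1)%N by lia.
by move/eqP; rewrite muln_eq1 => /andP[/eqP d1 /eqP e1]; apply/eqP; congr (_, _); apply: val_inj.
Qed.

(* Jacobi: [4 k] is a sum of four odd positive squares in [sigma(k)] ways,
   for [k] odd.  Both sides satisfy the same recursion. *)
Lemma odd_theta4_coef N m : (m %% 8 = 4)%N -> (m < N)%N ->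
  (odd_theta N ^+ 4)`_m = odd_divisor_sum N m.
Proof.
move=> m4 mN; apply/eqP; rewrite -subr_eq0; apply/eqP.
pose x m := (odd_theta N ^+ 4)`_m - odd_divisor_sum N m.
apply: (@odd_square_rec_unique N N 4 (fun m w => m.+1%:Z - 5 * (w * w)%N%:Z) x) => //.
  move=> m' m'4 m'N; under eq_bigr do rewrite mulrBr.
  by rewrite sumrB odd_theta4_rec odd_divisor_sum_rec //; lia.
(* The leading coefficient [m' + 1 - 5] vanishes only at 4, where both sides equal 1. *)
move=> m' m'4 m'N g0; have -> : m' = 4%N by lia.
rewrite /x odd_divisor_sum4; last by lia.
have N0 : (0 < N)%N by lia.
by rewrite !exprS expr0 !odd_theta_small // coef1.
Qed.

Definition conorm_count (N D : nat) : nat :=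
  \sum_(x < N.+1) \sum_(p : 'I_N.+1 * 'I_N.+1)
    [&& odd x, x == p.1 %[mod 4], p.1 == p.2 %[mod 4] &
        x * p.1 + p.1 * p.2 + p.2 * x == D]%N.

Lemma card_odd_lt (N d : nat) : (2 * d <= N)%N ->
  (\sum_(v < N.+1) (odd v && (v < 2 * d)%N) = d)%N.
Proof.
move=> dN.
rewrite (eq_bigr (fun v : 'I_N.+1 => if (v < 2 * d)%N then nat_of_bool (odd v) else 0%N)).
  rewrite -big_mkcond -(big_ord_widen _ (fun v => nat_of_bool (odd v))); last by lia.
  elim: d {dN} => [|d IH]; first by rewrite big_ord0.
  have -> : (2 * d.+1 = (2 * d).+2)%N by lia.
  by rewrite !big_ord_recr /= IH oddM /= ; lia.
by move=> v _; case: ifP; rewrite ?andbT ?andbF.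
Qed.

Lemma sum_pair (T1 T2 : finType) (F : T1 * T2 -> nat) :
  (\sum_p F p = \sum_x \sum_y F (x, y))%N.
Proof. by rewrite pair_big /=; apply: eq_bigr => -[]. Qed.

Lemma card_pair_sum (T1 T2 : finType) (A : {set T1 * T2}) :
  #|A| = (\sum_x \sum_y ((x, y) \in A))%N.
Proof.
rewrite -sum1_card big_mkcond pair_big /=.
by apply: eq_bigr => -[x y] _; case: (_ \in A).
Qed.

(** [card_sol] with its left side sorted by [w] and its right side sorted by the divisor pair. *)
Lemma conorm_count_sum N m : (m %% 8 = 4)%N -> (m < N)%N ->
  \sum_(w < N.+1 | odd w && (w * w <= m)%N) (conorm_count N (m - w * w))%:Z =
  odd_divisor_sum N m.
Proof.
move=> m4 mN; have [k Ek ok] : exists2 k, m = (4 * k)%N & odd k.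
  by exists (m %/ 4)%N; lia.
have mN' : (4 * k < N.+1)%N by lia.
have L : #|[set t : 'I_N.+1 * 'I_N.+1 * ('I_N.+1 * 'I_N.+1) |
      is_sol k t.1.1 t.1.2 t.2.1 t.2.2]| =
    (\sum_(w < N.+1 | odd w && (w * w <= m)) conorm_count N (m - w * w))%N.
  rewrite card_pair_sum sum_pair.
  rewrite [RHS]big_mkcond; apply: eq_bigr => w _.
  case: ifP => [/andP[ow wm]|hw].
    apply: eq_bigr => x _; apply: eq_bigr => -[y z] _; rewrite inE /is_sol /= ow -Ek /=.
    have -> : (w * w + (x * y + y * z + z * x) == m)%N = (x * y + y * z + z * x == m - w * w)%N.
      by move: (w * w)%N wm (x * y + y * z + z * x)%N => a am b; apply/eqP/eqP; lia.
    by [].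
  rewrite big1 // => x _; rewrite big1 // => -[y z] _; rewrite inE /is_sol /= -Ek.
  case: and5P => // -[ow _ _ _ /eqP E]; move: hw; rewrite ow /=.
  by rewrite -E leq_addr.
have R : #|[set t : 'I_N.+1 * 'I_N.+1 * 'I_N.+1 |
      [&& t.1.1 * t.1.2 == k, odd t.2 & t.2 < 2 * t.1.1]%N]|%:Z = odd_divisor_sum N m.
  rewrite card_pair_sum.
  rewrite (big_morph Posz PoszD (erefl 0%:Z)) /odd_divisor_sum [RHS]big_mkcond.
  apply: eq_bigr => -[d e] _; rewrite /= Ek eqn_pmul2l //.
  have -> : [&& odd d, odd e & (d * e == k)%N] = (d * e == k)%N.
    by case: eqP => [dek|]; rewrite ?andbF // andbT; move: ok; rewrite -dek oddM.
  case: eqP => [dek|dek].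
    have d2 : (2 * d <= N)%N.
      have : (d <= k)%N.
        by rewrite -dek leq_pmulr //; move: ok; rewrite -dek; case: (e : nat) => //; rewrite muln0.
      by lia.
    rewrite -[in RHS](card_odd_lt d2); congr Posz; apply: eq_bigr => v _.
    by rewrite inE /= dek eqxx.
  by rewrite big1 // => v _; rewrite inE /=; case: eqP dek.
rewrite -R -(card_sol ok mN') L.
by rewrite (big_morph Posz PoszD (erefl 0%:Z)).
Qed.

(** Convolution with the odd squares sends both sides to [odd_divisor_sum], by Jacobi's count for
    [theta^4] and by [conorm_count_sum]. It is injective on the class of 3 modulo 8, with leading
    coefficient 1. *)
Lemma odd_theta3_coef N m : (m %% 8 = 3)%N -> (m < N)%N ->
  (odd_theta N.+1 ^+ 3)`_m = (conorm_count N.+1 m)%:Z.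
Proof.
move=> m3 mN; apply/eqP; rewrite -subr_eq0; apply/eqP.
pose x m := (odd_theta N.+1 ^+ 3)`_m - (conorm_count N.+1 m)%:Z.
apply: (@odd_square_rec_unique N N.+1 3 (fun _ _ => 1) x) => //.
move=> m' m'3 m'N; under eq_bigr do rewrite mul1r.
rewrite sumrB conorm_count_sum; [|lia|lia].
by rewrite -coef_odd_thetaM -exprS odd_theta4_coef ?subrr; lia.
Qed.

Lemma sum_three_odd_squares D : (D %% 8 = 3)%N ->
  exists x y z, [/\ odd x, odd y, odd z & (x * x + y * y + z * z = D)%N].
Proof.
move=> D3; have h := odd_theta3_coef D3 (ltnSn D).
have cD : (0 < conorm_count D.+2 D)%N.
  (* The solution (1, 1, (D - 1) / 2); its last entry is 1 modulo 4 because [D] is 3 modulo 8. *)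
  have h1 : (1 < D.+3)%N by lia.
  have h2 : (D %/ 2 < D.+3)%N by lia.
  rewrite /conorm_count (bigD1 (Ordinal h1)) // (bigD1 (Ordinal h1, Ordinal h2)) //=.
  by apply: ltn_addr; apply: ltn_addr; rewrite lt0b; lia.
have /existsP[[x y] /existsP[z]] : [exists p : 'I_D.+3 * 'I_D.+3, [exists z : 'I_D.+3,
    [&& odd p.1, odd p.2, odd z & (p.1 * p.1 + p.2 * p.2 + z * z == D)%N]]].
  apply: contraT; rewrite negb_exists => /forallP nE.
  move: h; rewrite !exprS expr0 coef_odd_thetaM big1; first by lia.
  move=> x /andP[ox xD]; rewrite coef_odd_thetaM big1 // => y /andP[oy yD].
  rewrite coef_odd_thetaM big1 // => z /andP[oz zD]; rewrite coef1.
  have := nE (x, y); rewrite negb_exists => /forallP/(_ z); rewrite /= ox oy oz /= => /negP E.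
  by case: eqP => // E0; case: E; apply/eqP; lia.
move=> /and4P[/= ox oy oz /eqP E]; exists x, y, z; split=> //.
Qed.

(** * Partitions with prescribed sum of squares *)

(** Cauchy's lemma. Write [4 Q - N^2], which is 3 modulo 8, as [x^2 + y^2 + z^2]; the four parts are
    [(N + x + y + z) / 4] and its variants with two signs changed. *)
Lemma cauchy_four_squares (N Q : nat) : odd N -> odd Q ->
    (N * N < 4 * Q)%N -> (3 * Q < N * N + 2 * N + 4)%N ->
  exists a b c d : nat, (a + b + c + d = N)%N /\ (a * a + b * b + c * c + d * d = Q)%N.
Proof.
move=> oN oQ NQ QN.
have N8 := odd_square_mod8 oN.
have [|x [y [z [ox oy oz E]]]] := @sum_three_odd_squares (4 * Q - N * N).
  by move: (N * N)%N N8 NQ => i; lia.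
have {}E : (x * x + y * y + z * z + N * N = 4 * Q)%N.
  by move: (N * N)%N (x * x + y * y + z * z)%N NQ E => i j; lia.
(* Since [(x + y + z)^2 <= 3 (4 Q - N^2) < (N + 4)^2], the four numerators exceed -4; being
   divisible by 4, they are nonnegative. *)
have xyz : x%:Z + y%:Z + z%:Z < N%:Z + 4.
  rewrite ltNge; apply/negP => h.
  have h1 : (N%:Z + 4) * (N%:Z + 4) <= (x%:Z + y%:Z + z%:Z) * (x%:Z + y%:Z + z%:Z).
    by apply: ler_pM => //; lia.
  have h2 : 0 <= (x%:Z - y%:Z) * (x%:Z - y%:Z) by exact: sqr_ge0.
  have h3 : 0 <= (x%:Z - z%:Z) * (x%:Z - z%:Z) by exact: sqr_ge0.
  have h4 : 0 <= (y%:Z - z%:Z) * (y%:Z - z%:Z) by exact: sqr_ge0.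
  have E' : x%:Z * x + y%:Z * y + z%:Z * z + N%:Z * N = 4 * Q%:Z by lia.
  have QN' : 3 * Q%:Z < N%:Z * N + 2 * N%:Z + 4 by lia.
  by lia.
(* As [z] is odd, changing its sign shifts the sum by 2 modulo 4. *)
have [z' zz hz] : exists2 z' : int, (z' = z%:Z \/ z' = - z%:Z) &
    ((N%:Z + x%:Z + y%:Z + z') %% 4)%Z = 0.
  have [h|h] := eqVneq ((N%:Z + x%:Z + y%:Z + z%:Z) %% 4)%Z 0.
  - by exists z%:Z => //; left.
  - by exists (- z%:Z); [right | lia].
have [a Ea] : exists a : nat, N%:Z + x%:Z + y%:Z + z' = 4 * a%:Z.
  by exists (absz ((N%:Z + x%:Z + y%:Z + z') %/ 4)%Z); case: zz => zz; lia.
have [b Eb] : exists b : nat, N%:Z + x%:Z - y%:Z - z' = 4 * b%:Z.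
  by exists (absz ((N%:Z + x%:Z - y%:Z - z') %/ 4)%Z); case: zz => zz; lia.
have [c Ec] : exists c : nat, N%:Z - x%:Z + y%:Z - z' = 4 * c%:Z.
  by exists (absz ((N%:Z - x%:Z + y%:Z - z') %/ 4)%Z); case: zz => zz; lia.
have [d Ed] : exists d : nat, N%:Z - x%:Z - y%:Z + z' = 4 * d%:Z.
  by exists (absz ((N%:Z - x%:Z - y%:Z + z') %/ 4)%Z); case: zz => zz; lia.
exists a, b, c, d; split; first by lia.
have S : 16 * (a%:Z * a + b%:Z * b + c%:Z * c + d%:Z * d) = 16 * Q%:Z.
  have -> : 16 * (a%:Z * a + b%:Z * b + c%:Z * c + d%:Z * d) =
    (4 * a%:Z) * (4 * a%:Z) + (4 * b%:Z) * (4 * b%:Z) + (4 * c%:Z) * (4 * c%:Z) +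
    (4 * d%:Z) * (4 * d%:Z) by ring.
  rewrite -Ea -Eb -Ec -Ed.
  have zE : z' * z' = z%:Z * z by case: zz => ->; ring.
  have E' : x%:Z * x + y%:Z * y + z' * z' + N%:Z * N = 4 * Q%:Z by rewrite zE; lia.
  have -> : 16 * Q%:Z = 4 * (4 * Q%:Z) by ring.
  by rewrite -E'; ring.
by lia.
Qed.

Definition square_partition (r n q : nat) : Prop :=
  exists s : seq nat, [/\ size s = r, \sum_(x <- s) x = n & \sum_(x <- s) x * x = q]%N.

Lemma square_partition_cons r n q t : square_partition r n q ->
  square_partition r.+1 (t + n) (t * t + q).
Proof. by case=> s [<- <- <-]; exists (t :: s); rewrite /= !big_cons. Qed.

(** One part [t] is split off and the other four come from Cauchy's lemma with [N = n - t] and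
    [Q = q - t^2]. The largest admissible [t] of the right parity is taken: its own condition is
    [N^2 < 4 Q], and failure at [t + 2] yields the upper bound on [Q]. *)
Lemma square_partition5 n q : (600 <= n)%N -> odd n = odd q ->
    (n * n + 10 <= 5 * q)%N -> (16 * q <= 9 * (n * n))%N ->
  square_partition 5 n q.
Proof.
move=> n600 nq q1 q2.
pose P t := [&& odd (n + t), (t <= n)%N & ((n - t) * (n - t) + 4 * (t * t) < 4 * q)%N].
have [t0 Pt0] : exists t, P t.
  (* Near [n / 5] the quantity [(n - t)^2 + 4 t^2] attains its minimum, about [4 n^2 / 5]. The
     parity costs at most [|5 t - n| <= 5], and the summand 10 of the hypothesis absorbs it. *)
  have [t ot ht] : exists2 t, odd (n + t) & (n <= 5 * t + 4)%N /\ (5 * t <= n + 5)%N.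
    have [h|h] := boolP (odd (n + n %/ 5)).
    - by exists (n %/ 5)%N => //; lia.
    - by exists (n %/ 5).+1; lia.
  exists t; rewrite /P ot /=; apply/andP; split; first by lia.
  have [e Ee] : exists e : int, 5 * t%:Z = n%:Z + e by exists (5 * t%:Z - n%:Z); lia.
  have e5 : e * e <= 25 by nia.
  have k1 : n%:Z * n + 10 <= 5 * q%:Z by lia.
  have tn : (t <= n)%N by lia.
  have k2 : 5 * ((n%:Z - t%:Z) * (n%:Z - t%:Z) + 4 * (t%:Z * t)) = (5 * t%:Z - n%:Z) * (5 * t%:Z - n%:Z) + 4 * (n%:Z * n) by ring.
  rewrite Ee in k2.
  have k3 : n%:Z + e - n%:Z = e by ring.
  rewrite k3 in k2.
  have k4 : (n%:Z - t%:Z) * (n%:Z - t%:Z) + 4 * (t%:Z * t) < 4 * q%:Z by lia.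
  have En : (n - t)%N%:Z = n%:Z - t%:Z by lia.
  have : ((n - t) * (n - t) + 4 * (t * t))%N%:Z < (4 * q)%N%:Z.
    by rewrite PoszD !PoszM En.
  by rewrite ltz_nat.
have Pn t : P t -> (t <= n)%N by case/and3P.
have [t Pt tmax] := ex_maxnP (ex_intro _ t0 Pt0) Pn.
case/and3P: (Pt) => ot tn ht.
have [N En] : exists N, n = (N + t)%N by exists (n - t)%N; lia.
have EN : (n - t = N)%N by lia.
rewrite EN in ht.
have tq : (4 * t < 3 * n)%N.
  rewrite ltnNge; apply/negP => h.
  have := leq_mul h h; move: ht q2; have -> : (3 * n * (3 * n) = 9 * (n * n))%N by ring.
  have -> : (4 * t * (4 * t) = 16 * (t * t))%N by ring.
  by move: (t * t)%N (n * n)%N (N * N)%N => i j k; lia.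
have nP2 : ~~ P t.+2 by apply/negP => /tmax; lia.
have hN : (4 * q <= (N - 2) * (N - 2) + 4 * (t.+2 * t.+2))%N.
  move: nP2; rewrite /P; have -> : odd (n + t.+2) by move: ot; lia.
  have -> : (t.+2 <= n)%N by lia.
  have -> : (n - t.+2 = N - 2)%N by lia.
  by rewrite /= -leqNgt.
have [Q EQ] : exists Q, q = (t * t + Q)%N.
  by exists (q - t * t)%N; move: ht; move: (N * N)%N (t * t)%N => i j; lia.
have [M EM] : exists M, N = (M + 2)%N by exists (N - 2)%N; lia.
have [|||| a [b [c [d [E1 E2]]]]] := @cauchy_four_squares N Q.
- by move: ot; rewrite En; lia.
- have : odd (t * t) = odd t by rewrite oddM andbb.
  by move: ot nq; rewrite En EQ; move: (t * t)%N => i; lia.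
- by move: ht; rewrite EQ; move: (N * N)%N (t * t)%N => i j; lia.
(* The error terms are linear in [t] and hence in [N], as [t < 3 n / 4]. They are dominated by [N^2]
   because [n >= 600] gives [N > 150]. *)
- move: hN; rewrite EQ EM addnK.
  have M148 : (148 <= M)%N by lia.
  have := leq_mul M148 (leqnn M); have tM : (t <= 3 * M + 5)%N by lia.
  have -> : (t.+2 * t.+2 = t * t + 4 * t + 4)%N by ring.
  have -> : ((M + 2) * (M + 2) = M * M + 4 * M + 4)%N by ring.
  by move: (M * M)%N (t * t)%N => i j; lia.
exists [:: t; a; b; c; d]; split=> //.
- by rewrite !big_cons big_nil; lia.
- by rewrite !big_cons big_nil EQ -E2; lia.
Qed.

(** Induction on [r]. If [q] is large enough for [r] parts, a part 0 is added. Otherwise [q] is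
    close to its minimum and the part [n / (r + 1)], near the mean, is split off. *)
Lemma square_partition_large r : (5 <= r)%N -> exists n0 C : nat,
  forall n q, (n0 <= n)%N -> odd n = odd q -> (n * n + C <= r * q)%N ->
    (16 * q <= 9 * (n * n))%N -> square_partition r n q.
Proof.
elim: r => // r IH; rewrite leq_eqVlt => /orP[/eqP <-|r5].
  by exists 600%N, 10%N; exact: square_partition5.
have {}r5 : (5 <= r)%N by [].
have [n0 [C IHr]] := IH r5.
exists (2 * n0 + C + 10)%N, (2 * C + r)%N => n q hn nq q1 q2.
have [h|h] := leqP (n * n + C) (r * q).
  rewrite -[n]add0n -[q]add0n -{2}(mul0n 0); apply: square_partition_cons.
  by apply: IHr => //; lia.
pose t := (n %/ r.+1)%N.
have [N En] : exists N, n = (t + N)%N.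
  by exists (n - t)%N; rewrite subnKC // leq_div.
have [p pr Ep] : exists2 p, (p <= r)%N & n = (r.+1 * t + p)%N.
  by exists (n %% r.+1)%N; [rewrite -ltnS ltn_mod | rewrite mulnC -divn_eq].
have ENp : N = (r * t + p)%N by lia.
have t6 : (6 * t <= n)%N.
  have : (6 * t <= r.+1 * t)%N by rewrite leq_mul2r; lia.
  by lia.
(* The exact loss in the inequality: apart from the rounding term [p^2 <= r^2], splitting off the
   mean turns the bound for [r + 1] parts into the bound for [r] parts. This explains the constant
   [2 C + r]. *)
have tr : (r.+1 * (N * N + r * (t * t)) = r * (n * n) + p * p)%N.
  by rewrite ENp Ep -addn1; ring.
have pp : (p * p <= r * r)%N by exact: leq_mul.
have q1' : (r * (n * n) + r * (2 * C + r) <= r.+1 * (r * q))%N.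
  by rewrite -mulnDr mulnCA leq_mul2l q1 orbT.
have rC : (r.+1 * C + r * r <= r * (2 * C + r))%N.
  have : (5 * C <= r * C)%N by rewrite leq_mul2r r5 orbT.
  by lia.
have K : (N * N + r * (t * t) + C <= r * q)%N.
  rewrite -(leq_pmul2l (ltn0Sn r)) mulnDr tr.
  by move: (r * (n * n))%N (p * p)%N (r * r)%N (r * (2 * C + r))%N (r.+1 * (r * q))%N q1' rC pp; lia.
have tq : (t * t <= q)%N.
  have r0 : (0 < r)%N by lia.
  rewrite -(leq_pmul2l r0).
  by move: (N * N)%N (r * (t * t))%N (r * q)%N K; lia.
have [Q EQ] : exists Q, q = (t * t + Q)%N by exists (q - t * t)%N; rewrite subnKC.
rewrite En EQ; apply: square_partition_cons; apply: IHr.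
- by lia.
- have E : odd (t * t) = odd t by rewrite oddM andbb.
  by move: nq; rewrite En EQ !oddD E; case: (odd t); case: (odd N); case: (odd Q).
- by move: K; rewrite EQ mulnDr; move: (N * N)%N (r * (t * t))%N (r * Q)%N; lia.
- have q5 : (5 * q < n * n + C)%N.
    by apply: leq_ltn_trans h; rewrite leq_mul2r r5 orbT.
  have nC : (C <= n * n)%N.
    by apply: (@leq_trans n); [lia | rewrite leq_pmulr //; lia].
  have Nn : (5 * n <= 6 * N)%N by lia.
  have := leq_mul Nn Nn.
  have -> : (5 * n * (5 * n) = 25 * (n * n))%N by ring.
  have -> : (6 * N * (6 * N) = 36 * (N * N))%N by ring.
  have : (Q <= q)%N by rewrite EQ leq_addl.
  move: (N * N)%N (n * n)%N q5 nC => i j; lia.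
Qed.

Local Close Scope ring_scope.

(** * Graphs without induced subgraphs of size [f] *)

Lemma bin2E n : (2 * 'C(n, 2) + n = n * n)%N.
Proof. by rewrite mul2n bin2 -[RHS]odd_double_half oddM andbb; case: n => [|n] //=; nia. Qed.

Lemma sum_of_binomials1 m : (0 < m)%N -> sum_of_binomials m 'C(m, 2) 1.
Proof. by move=> m0; exists (fun=> m); rewrite !big_ord1. Qed.

Lemma sum_of_binomials2 x y : (0 < x)%N -> (0 < y)%N ->
  sum_of_binomials (x + y) ('C(x, 2) + 'C(y, 2)) 2.
Proof.
move=> x0 y0; exists (fun i : 'I_2 => if i == ord0 then x else y).
by split=> [i||]; rewrite ?big_ord_recl ?big_ord0 ?addn0 //; case: ifP.
Qed.

Local Open Scope ring_scope.

(* With [k = m - 2 c], the three expressions of [f] give [(a - b) (a + b - 1) = m - k^2],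
   while [a + b - 1 >= m] and, if [f] is as large as a two-clique count, [k^2 <= 2 m]. *)
Lemma lt_two_cliques (m f a b c : nat) : (2 <= m)%N -> (0 < a)%N -> (0 < b)%N -> (0 < c)%N ->
    f = 'C(a, 2) -> f%:Z = 'C(m, 2)%:Z - 'C(b, 2)%:Z -> f%:Z = c%:Z * (m%:Z - c%:Z) ->
    ~ sum_of_binomials m f 1 -> ~ sum_of_binomials m f 2 ->
  forall x, (x <= m)%N -> (f < 'C(x, 2) + 'C(m - x, 2))%N.
Proof.
move=> m2 a0 b0 c0 fa fb fc n1 n2 x xm; rewrite ltnNge; apply/negP => fx.
have Ea := bin2E a; have Eb := bin2E b; have Em := bin2E m; have Ex := bin2E x.
have Ey := bin2E (m - x).
have [y Ym] : exists y, m = (x + y)%N by exists (m - x)%N; lia.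
have yE : (m - x = y)%N by lia.
rewrite yE in fx Ey.
have cm : (c <= m)%N by nia.
have [d Ed] : exists d, m = (c + d)%N by exists (m - c)%N; lia.
have fcd : f = (c * d)%N by nia.
have ab : a%:Z * a - a%:Z + b%:Z * b - b%:Z = m%:Z * m - m%:Z by lia.
have abm : m%:Z <= a%:Z + b%:Z - 1 by nia.
have kE : (a%:Z - b%:Z) * (a%:Z + b%:Z - 1) = m%:Z - (c%:Z - d%:Z) * (c%:Z - d%:Z).
  have -> : (a%:Z - b%:Z) * (a%:Z + b%:Z - 1) = (a%:Z * a - a%:Z) - (b%:Z * b - b%:Z) by ring.
  have f4 : 4 * f%:Z = m%:Z * m - (c%:Z - d%:Z) * (c%:Z - d%:Z).
    by rewrite fcd Ed PoszD PoszM; ring.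
  by lia.
have k0 : 0 <= (c%:Z - d%:Z) * (c%:Z - d%:Z) by exact: sqr_ge0.
have k2 : (c%:Z - d%:Z) * (c%:Z - d%:Z) <= 2 * m%:Z.
  have := sqr_ge0 (x%:Z - y%:Z).
  have -> : (x%:Z - y%:Z) ^+ 2 = 2 * (x%:Z * x + y%:Z * y) - m%:Z * m by rewrite Ym PoszD; ring.
  have f4 : 4 * f%:Z = m%:Z * m - (c%:Z - d%:Z) * (c%:Z - d%:Z).
    by rewrite fcd Ed PoszD PoszM; ring.
  by lia.
(* If [a = b], then [f] is half of [C(m, 2)], so [c d] edges run between parts of sizes [c] and [d]
   and equally many inside them: [f] is a two-clique count. *)
have [eab|nab] := eqVneq a b.
  have Ef : f = ('C(c, 2) + 'C(d, 2))%N.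
    have Ec := bin2E c; have Edd := bin2E d.
    have : m%:Z * m = c%:Z * c + d%:Z * d + 2 * f%:Z by rewrite Ed fcd PoszD PoszM; ring.
    by rewrite eab in fa Ea; lia.
  case: (posnP d) => [d0|d0].
    have bm : 'C(m, 2) = 0%N by rewrite d0 muln0 in fcd; rewrite eab in fa; lia.
    by rewrite bm in Em; have := leq_mul m2 (leqnn m); lia.
  by apply: n2; rewrite Ed Ef; exact: sum_of_binomials2.
(* Since [0 <= k^2 <= 2 m], the product [(a - b) (a + b - 1)] has absolute value at most [m], while
   its second factor is at least [m]. The relation between [a], [b] and [m] then becomes
   [(a - 1) (b - 1) = 0]. *)
have abE : a%:Z + b%:Z - 1 = m%:Z.
  have [lab|lab] : (a < b)%N \/ (b < a)%N by lia.
  - have : 0 <= (b%:Z - a%:Z - 1) * (a%:Z + b%:Z - 1) by apply: mulr_ge0; lia.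
    by lia.
  - have : 0 <= (a%:Z - b%:Z - 1) * (a%:Z + b%:Z - 1) by apply: mulr_ge0; lia.
    by lia.
have : (a%:Z - 1) * (b%:Z - 1) = 0 by rewrite -abE in ab; lia.
move/eqP; rewrite mulf_eq0 => /orP[/eqP h|/eqP h].
- have a1 : a = 1%N by lia.
  have f0 : f = 0%N by rewrite fa a1.
  have le1 z : (2 * 'C(z, 2) + z = z * z)%N -> 'C(z, 2) = 0%N -> (z <= 1)%N.
    move=> Ez z0; rewrite leqNgt; apply/negP => z2.
    by have := leq_mul z2 (leqnn z); lia.
  have x1 : x = 1%N by have := le1 x Ex; have := le1 y Ey; lia.
  have y1 : y = 1%N by have := le1 x Ex; have := le1 y Ey; lia.
  by apply: n2; rewrite Ym f0 x1 y1; exact: (@sum_of_binomials2 1 1).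
- have b1 : b = 1%N by lia.
  apply: n1; have -> : f = 'C(m, 2) by move: fb; rewrite b1 (_ : 'C(1, 2) = 0%N) //; lia.
  by apply: sum_of_binomials1; lia.
Qed.

Local Close Scope ring_scope.

(** The disjoint union of cliques on the fibres of [g]. *)
Definition mono_edges (V I : finType) (g : V -> I) : {set {set V}} :=
  [set X : {set V} | (#|X| == 2) && [exists i, X \subset [set v | g v == i]]].

Lemma simple_mono_edges (V I : finType) (g : V -> I) : simple_graph (mono_edges g).
Proof. by apply/forallP => X; apply/implyP; rewrite inE => /andP[]. Qed.

Lemma card_induced_mono_edges (V I : finType) (g : V -> I) (A : {set V}) :
  #|induced_edges (mono_edges g) A| = \sum_i 'C(#|A :&: [set v | g v == i]|, 2).
Proof.
rewrite -sum1_card big_mkcond /=.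
under [RHS]eq_bigr => i _ do rewrite -cards_draws -sum1_card big_mkcond /=.
rewrite exchange_big /=; apply: eq_bigr => X _; rewrite !inE.
have [X2|X2] /= := eqVneq #|X| 2; last first.
  by rewrite big1 // => i _; rewrite inE (negbTE X2) andbF.
have [/existsP[i Xi]|/existsPn nX] /= :=
  boolP [exists i, X \subset [set v | g v == i]].
  rewrite (bigD1 i) //= big1 => [|j ji].
    by rewrite addn0 inE X2 eqxx andbT subsetI Xi andbT.
  rewrite inE subsetI; case: ifP => // /andP[/andP[_ Xj] _].
  have /card_gt0P[v vX] : 0 < #|X| by rewrite X2.
  move/subsetP/(_ v vX): Xi; move/subsetP/(_ v vX): Xj; rewrite !inE => /eqP Ej /eqP Ei.
  by rewrite -Ej Ei eqxx in ji.
by rewrite big1 // => i _; rewrite inE subsetI (negbTE (nX i)) andbF.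
Qed.

Lemma card_mono_edges (V I : finType) (g : V -> I) :
  #|mono_edges g| = \sum_i 'C(#|[set v | g v == i]|, 2).
Proof.
have -> : mono_edges g = induced_edges (mono_edges g) setT.
  by apply/setP => X; rewrite !inE subsetT andbT.
by rewrite card_induced_mono_edges; apply: eq_bigr => i _; rewrite setTI.
Qed.

(** A vertex set may miss some cliques, whereas [sum_of_binomials] asks for positive parts; empty
    parts change neither sum. *)
Lemma sum_of_binomials_drop0 (I : finType) (y : I -> nat) m f :
    0 < m -> \sum_i y i = m -> \sum_i 'C(y i, 2) = f ->
  exists2 s, s.+1 <= #|I| & sum_of_binomials m f s.+1.
Proof.
move=> m0 ym yf; pose P := [pred i | 0 < y i].
have P0 : 0 < #|P|.
  rewrite lt0n; apply/negP => /eqP/card0_eq nP.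
  move: m0; rewrite -ym big1 // => i _; apply/eqP; rewrite -leqn0 leqNgt.
  by have := nP i; rewrite !inE => ->.
exists #|P|.-1; rewrite (prednK P0); first exact: max_card.
exists (fun i => y (enum_val i)); split.
- by move=> i; have := enum_valP i.
- rewrite -ym (bigID P) /= [X in _ = _ + X]big1 ?addn0; last first.
    by move=> i; rewrite -eqn0Ngt => /eqP.
  by rewrite -(@big_enum_val _ _ _ _ P y); apply: eq_bigl => i; rewrite inE.
- rewrite -yf (bigID P) /= [X in _ + X]big1 ?addn0; last first.
    by move=> i; rewrite -eqn0Ngt => /eqP ->.
  by rewrite -(@big_enum_val _ _ _ _ P (fun i => 'C(y i, 2))); apply: eq_bigl => i; rewrite inE.
Qed.

Lemma sum_card_fibers (V I : finType) (g : V -> I) (A : {set V}) :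
  \sum_i #|A :&: [set v | g v == i]| = #|A|.
Proof.
rewrite -sum1_card (partition_big g xpredT) //=; apply: eq_bigr => i _.
by rewrite -sum1_card; apply: eq_bigl => v; rewrite !inE.
Qed.

Lemma not_arrow_cliques n (r m f e : nat) (g : 'I_n -> 'I_r) :
    0 < m -> (forall s, sum_of_binomials m f s.+1 -> r <= s) ->
    e = \sum_i 'C(#|[set v | g v == i]|, 2) ->
  ~~ arrow n e m f.
Proof.
move=> m0 rmin Ee; apply/forallPn; exists (mono_edges g).
rewrite simple_mono_edges card_mono_edges -Ee eqxx /= negb_exists; apply/forallP => A.
apply/negP => /andP[/eqP Am /eqP]; rewrite card_induced_mono_edges => Af.
have [|s sr sob] := sum_of_binomials_drop0 m0 _ Af.
  by rewrite -Am; exact: sum_card_fibers.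
by have := rmin s sob; rewrite card_ord in sr; rewrite leqNgt sr.
Qed.

Lemma colouring_exists (s : seq nat) r n : size s = r.+1 -> \sum_(x <- s) x = n ->
  exists g : 'I_n -> 'I_r.+1, forall i, #|[set v | g v == i]| = nth 0 s i.
Proof.
move=> sr sn.
pose t := flatten [seq nseq (nth 0 s i) i | i <- iota 0 r.+1].
have ct i : i < r.+1 -> count_mem i t = nth 0 s i.
  move=> ir; rewrite /t count_flatten -map_comp sumnE big_map.
  rewrite (bigD1_seq i) ?mem_iota ?iota_uniq //= big1 ?addn0.
    by rewrite count_nseq /= eqxx mul1n.
  by move=> j ji; rewrite count_nseq /= (negbTE ji) mul0n.
have tn : size t = n.
  rewrite -sn /t size_flatten /shape -map_comp sumnE big_map [RHS](big_nth 0) sr.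
  by rewrite /index_iota subn0; apply: eq_bigr => i _; rewrite /= size_nseq.
have tr j : j < n -> nth 0 t j < r.+1.
  move=> jn; have : nth 0 t j \in t by rewrite mem_nth // tn.
  move/flatten_mapP => [i]; rewrite mem_iota add0n => /andP[_ ir].
  by rewrite mem_nseq => /andP[_ /eqP ->].
exists (fun j => inord (nth 0 t j)) => i.
rewrite -(ct i (ltn_ord i)) -[t in RHS](mkseq_nth 0) tn /mkseq -val_enum_ord -map_comp count_map.
rewrite -sum1_card -sum1_count big_enum_cond; apply: eq_bigl => j /=.
rewrite inE -val_eqE /= inordK //; exact: tr.
Qed.

Lemma subset_card_between (T : finType) (A B : {set T}) e :
  A \subset B -> #|A| <= e <= #|B| -> exists2 C : {set T}, (A \subset C) && (C \subset B) & #|C| = e.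
Proof.
move=> AB /andP[Ae]; elim: e Ae => [|e IH] Ae eB.
  by exists A; rewrite ?subxx //; move: Ae; rewrite leqn0 => /eqP.
move: Ae; rewrite leq_eqVlt => /orP[/eqP EA|Ae]; first by exists A; rewrite ?subxx.
have [|C /andP[AC CB] Ce] := IH Ae; first exact: ltnW.
have /properP[_ [x xB xC]] : C \proper B by rewrite properEcard CB Ce.
exists (x |: C); last by rewrite cardsU1 xC Ce.
by rewrite (subset_trans AC (subsetUr _ _)) subUset sub1set xB.
Qed.

(** Any [e] in this range is reached by adding edges to two disjoint cliques that cover the
    vertices, and every [m]-set keeps more than [f] edges. *)
Lemma not_arrow_cobipartite n m f e h : h <= n ->
    (forall x, x <= m -> f < 'C(x, 2) + 'C(m - x, 2)) ->
    'C(h, 2) + 'C(n - h, 2) <= e <= 'C(n, 2) ->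
  ~~ arrow n e m f.
Proof.
move=> hn fx eb.
have [||g gP] := @colouring_exists [:: h; n - h] 1 n => //.
  by rewrite !big_cons big_nil; lia.
pose all2 := [set X : {set 'I_n} | #|X| == 2].
have call : #|all2| = 'C(n, 2).
  by rewrite card_draws card_ord.
have sub : mono_edges g \subset all2 by apply/subsetP => X; rewrite !inE => /andP[].
have [|E /andP[gE Eall] Ee] := @subset_card_between _ _ _ e sub.
  rewrite call card_mono_edges !big_ord_recl big_ord0 !gP /= addn0; exact: eb.
apply/forallPn; exists E; rewrite Ee eqxx andbT.
have -> /= : simple_graph E.
  by apply/forallP => X; apply/implyP => /(subsetP Eall); rewrite inE.
rewrite negb_exists; apply/forallP => A; apply/negP => /andP[/eqP Am /eqP Af].
have le1 : #|induced_edges (mono_edges g) A| <= f.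
  rewrite -Af; apply: subset_leq_card; apply/subsetP => X; rewrite !inE => /andP[/andP[h1 h2] ->].
  by rewrite andbT; apply: (subsetP gE); rewrite inE h1.
move: le1; rewrite card_induced_mono_edges !big_ord_recl big_ord0 addn0.
have := sum_card_fibers g A; rewrite !big_ord_recl big_ord0 addn0 Am.
set x := #|_|; set y := #|_| => xy.
have Ey : m - x = y by lia.
by have := fx x; rewrite Ey; lia.
Qed.

(** * The theorems of Erdos-Stone and Ramsey *)

Lemma pigeonhole_fiber (T U : finType) (f : T -> U) (A : {set T}) (B : {set U}) k :
    (forall x, x \in A -> f x \in B) -> k * #|B| < #|A| ->
  exists2 u, u \in B & k < #|[set x in A | f x == u]|.
Proof.
move=> fB kB; apply/exists_inP; apply: contraLR kB => /exists_inPn h; rewrite -leqNgt.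
have -> : #|A| = \sum_(u in B) #|[set x in A | f x == u]|.
  rewrite -sum1_card (partition_big f (mem B)) //=.
  by apply: eq_bigr => u _; rewrite -sum1_card; apply: eq_bigl => x; rewrite inE.
rewrite mulnC -sum_nat_const; apply: leq_sum => u uB.
by rewrite leqNgt; exact: h.
Qed.

Definition subset_of_card (V : finType) (t : nat) (A : {set V}) : {set V} :=
  [set x in take t (enum A)].

Lemma subset_of_cardS (V : finType) t (A : {set V}) : subset_of_card t A \subset A.
Proof. by apply/subsetP => x; rewrite inE => /mem_take; rewrite mem_enum. Qed.

Lemma card_subset_of_card (V : finType) t (A : {set V}) :
  t <= #|A| -> #|subset_of_card t A| = t.
Proof.
move=> tA; rewrite cardsE (card_uniqP _) ?take_uniq ?enum_uniq //.
by rewrite size_takel // -cardE.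
Qed.

Section CompletePartite.

Variables (V : finType) (E : rel V).

Definition complete_between (A B : {set V}) :=
  [forall x in A, forall y in B, E x y && E y x].

Lemma complete_betweenP (A B : {set V}) : reflect (forall x y, x \in A -> y \in B -> E x y /\ E y x)
  (complete_between A B).
Proof.
apply: (iffP forall_inP) => [h x y xA yB|h x xA].
  by have /forall_inP/(_ y yB)/andP := h x xA.
by apply/forall_inP => y yB; apply/andP; exact: h.
Qed.

Definition degree_in (U : {set V}) x := #|[set y in U | E x y]|.

Definition is_part (U : {set V}) t (A : {set V}) := (A \subset U) && (#|A| == t).

Hypotheses (Esym : symmetric E) (Eirr : irreflexive E).

(** The induction step of Erdos-Stone. Counting edges between the union [W] of the parts and [U]
    shows that many vertices have at least [t] neighbours in every part. By pigeonhole, [t] of them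
    have the same neighbourhood in [W]; they form the new part, and the old parts shrink into that
    neighbourhood. *)
Lemma complete_partite_step (U : {set V}) (p q r t : nat) (ps : seq {set V}) :
    0 < t -> 0 < q -> r.-1 * q < r * p -> 0 < size ps <= r ->
    (forall a, a \in U -> p * (2 * #|U| - 1) <= 2 * q * degree_in U a) ->
    all (is_part U (2 * q * t)) ps -> pairwise complete_between ps ->
    r * p + 2 * q * (t * 2 ^ (r * (2 * q * t))).+1 <= #|U| ->
  exists ps', [/\ size ps' = (size ps).+1, all (is_part U t) ps' & pairwise complete_between ps'].
Proof.
set T := 2 * q * t => t0 q0 pqr /andP[ps0 psr] degU Pps Cps Ubig.
set j := size ps in ps0 psr *.
pose W := \bigcup_(A <- ps) A.
have WU : W \subset U.
  apply/subsetP => x; rewrite /W; elim: (ps) Pps => [|A s IH] /=; first by rewrite big_nil inE.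
  by move=> /andP[/andP[/subsetP AU _] Ps]; rewrite big_cons inE => /orP[/AU|/(IH Ps)].
have disj (A B : {set V}) : complete_between A B -> [disjoint A & B].
  move=> /complete_betweenP h; rewrite -setI_eq0; apply/eqP/setP => x; rewrite !inE.
  by apply/negP => /andP[xA xB]; have [] := h x x xA xB; rewrite Eirr.
have sumW (F : V -> nat) : \sum_(x in W) F x = \sum_(A <- ps) \sum_(x in A) F x.
  rewrite /W; elim: (ps) Cps => [|A s IH] /=; first by rewrite !big_nil big_set0.
  move=> /andP[/allP As Cs]; rewrite !big_cons -IH //.
  rewrite (eq_bigl [predU A & \bigcup_(B <- s) B]) => [|x]; last by rewrite !inE.
  rewrite bigU //= -setI_eq0; apply/eqP/setP => x; rewrite !inE; apply/negP => /andP[xA].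
  move=> xs; suff [B Bs xB] : exists2 B, B \in s & x \in B.
    by have := disj _ _ (As B Bs); rewrite -setI_eq0 => /eqP/setP/(_ x); rewrite !inE xA xB.
  elim: (s) xs => [|B s' IH']; first by rewrite big_nil inE.
  rewrite big_cons inE => /orP[xB|/IH'[C Cs' xC]]; first by exists B => //; rewrite mem_head.
  by exists C => //; rewrite inE Cs' orbT.
have cardW : #|W| = j * T.
  rewrite -sum1_card sumW (eq_big_seq (fun=> T)) => [|A Aps].
    by rewrite big_const_seq count_predT iter_addn_0 mulnC.
  by rewrite sum1_card; have /allP/(_ A Aps)/andP[_ /eqP] := Pps.
pose tr v := [set a in W | E a v].
pose G := [set v in U | all (fun A => t <= #|A :&: tr v|) ps].
have cardtr v : #|tr v| = \sum_(A <- ps) #|A :&: tr v|.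
  rewrite -sum1_card [LHS](eq_bigl (fun a => (a \in W) && E a v)) => [|a]; last by rewrite !inE.
  rewrite big_mkcondr sumW; apply: eq_big_seq => A Aps.
  rewrite -big_mkcondr -sum1_card; apply: eq_bigl => a; rewrite !inE.
  case aA: (a \in A) => //=.
  suff -> : a \in W by [].
  by rewrite /W (big_rem A) //= inE aA.
have trle (A : {set V}) v : A \in ps -> #|A :&: tr v| <= T.
  move=> Aps; have /allP/(_ A Aps)/andP[_ /eqP <-] := Pps.
  exact/subset_leq_card/subsetIl.
have trbad v : v \in U -> v \notin G -> #|tr v| <= j.-1 * T + t.
  rewrite inE => -> /= /allPn[A Aps]; rewrite -ltnNge => hA.
  rewrite cardtr (big_rem A) //= addnC; apply: leq_add; last exact: ltnW.
  apply: leq_trans (_ : \sum_(B <- rem A ps) T <= _).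
    rewrite [leqLHS]big_seq [leqRHS]big_seq; apply: leq_sum => B /mem_rem; exact: trle.
  by rewrite big_const_seq count_predT iter_addn_0 size_rem // mulnC.
have trall v : #|tr v| <= j * T.
  by rewrite -cardW; apply: subset_leq_card; apply/subsetP => a; rewrite inE => /andP[].
have tT : t <= T by rewrite /T leq_pmull // muln_gt0.
have count1 : \sum_(v in U) #|tr v| = \sum_(a in W) degree_in U a.
  under eq_bigr => v _ do rewrite -sum1_card big_mkcond.
  rewrite exchange_big [RHS]big_mkcond; apply: eq_bigr => a _.
  case: ifP => aW; last by rewrite big1 // => v _; rewrite inE aW.
  rewrite /degree_in -sum1_card -big_mkcondr; apply: eq_bigl => v.
  by rewrite !inE aW.
have count2 : \sum_(v in U) #|tr v| <= #|U| * (j.-1 * T + t) + #|G| * (T - t).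
  rewrite (bigID (mem G)) /=.
  have -> : #|U| = \sum_(v in U | v \in G) 1 + \sum_(v in U | v \notin G) 1.
    by rewrite -bigID sum1_card.
  have -> : #|G| = \sum_(v in U | v \in G) 1.
    by rewrite -sum1_card; apply: eq_bigl => v; rewrite !inE; case: (v \in U).
  have s1 : \sum_(v in U | v \in G) #|tr v| <=
      (\sum_(v in U | v \in G) 1) * ((j.-1 * T + t) + (T - t)).
    rewrite big_distrl /=; apply: leq_sum => v _; rewrite mul1n.
    by apply: leq_trans (trall v) _; rewrite -{1}(prednK ps0) mulSn; lia.
  have s2 : \sum_(v in U | v \notin G) #|tr v| <=
      (\sum_(v in U | v \notin G) 1) * (j.-1 * T + t).
    rewrite big_distrl /=; apply: leq_sum => v /andP[vU vG]; rewrite mul1n.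
    exact: trbad.
  by rewrite mulnDl addnAC -mulnDr; exact: leq_add.
have count3 : j * T * (p * (2 * #|U| - 1)) <= 2 * q * \sum_(a in W) degree_in U a.
  rewrite -cardW -sum_nat_const big_distrr /=; apply: leq_sum => a aW.
  by apply: degU; exact: (subsetP WU).
have jpq : j.-1 * q < j * p.
  move: pqr psr ps0; case: (j) => // j' ; case: (r) => // r' /= h1 h2 _.
  have : p <= q \/ q < p by lia.
  case=> pq; last by nia.
  nia.
(* A vertex outside [G] sees at most [(j - 1) T + t] vertices of [W], where [t = T / (2 q)], while
   the average is about [(j - 1 + 1 / q) T] or more. The surplus [T / (2 q)] must come from [G]. *)
have Gbig : #|U| <= r * p + 2 * q * #|G|.
  have T0 : 0 < T by rewrite !muln_gt0 q0.
  rewrite -(leq_pmul2l T0).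
  have h1 : j * T * (p * (2 * #|U| - 1)) <= 2 * q * (#|U| * (j.-1 * T + t) + #|G| * (T - t)).
    by apply: leq_trans count3 _; rewrite leq_mul2l -count1 count2 orbT.
  have h2 : #|G| * (T - t) <= #|G| * T by rewrite leq_mul2l leq_subr orbT.
  have h3 : j * p <= r * p by rewrite leq_mul2r psr orbT.
  have [u Eu] : exists u, #|U| = u.+1 by exists #|U|.-1; lia.
  move: h1 h2 h3 jpq; rewrite Eu.
  move: (#|G| * (T - t)) => g1; move: #|G| => g h1 h2 h3 jpq.
  have ET : T = 2 * q * t by [].
  have k1 : (j.-1 * q).+1 * T * (2 * u.+1 - 1) <= j * p * T * (2 * u.+1 - 1).
    by rewrite leq_mul2r leq_mul2r jpq !orbT.
  have k2 : j * T * (p * (2 * u.+1 - 1)) = j * p * T * (2 * u.+1 - 1) by ring.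
  have k3 : 2 * q * (u.+1 * (j.-1 * T + t) + g1) =
    2 * (j.-1 * q * T * u.+1) + T * u.+1 + 2 * q * g1 by rewrite ET; ring.
  have k4 : (j.-1 * q).+1 * T * (2 * u.+1 - 1) + (j.-1 * q).+1 * T =
    2 * (j.-1 * q * T * u.+1) + 2 * (T * u.+1).
    have -> : 2 * u.+1 - 1 = 2 * u + 1 by lia.
    by rewrite -[(j.-1 * q).+1]addn1 -[u.+1]addn1; ring.
  have k5 : (j.-1 * q).+1 * T <= r * p * T.
    by rewrite leq_mul2r (leq_trans jpq h3) orbT.
  have k6 : 2 * q * g1 <= 2 * q * (g * T) by rewrite leq_mul2l h2 orbT.
  rewrite mulnDr; have -> : T * (2 * q * g) = 2 * q * (g * T) by ring.
  have -> : T * (r * p) = r * p * T by ring.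
  move: k1 k2 k3 k4 k5 k6 h1.
  move: (2 * q * (g * T)) (2 * q * g1) (r * p * T) ((j.-1 * q).+1 * T) (j.-1 * q * T * u.+1)
    (T * u.+1) (j * p * T * (2 * u.+1 - 1)) ((j.-1 * q).+1 * T * (2 * u.+1 - 1)) => *.
  by lia.
have Glarge : t * #|powerset W| < #|G|.
  rewrite card_powerset cardW.
  have h1 : 2 ^ (j * T) <= 2 ^ (r * T) by rewrite leq_exp2l // leq_mul2r psr orbT.
  have h2 : t * 2 ^ (j * T) <= t * 2 ^ (r * T) by rewrite leq_mul2l h1 orbT.
  apply: leq_ltn_trans h2 _.
  have : 2 * q * (t * 2 ^ (r * T)).+1 <= 2 * q * #|G| by lia.
  by rewrite leq_pmul2l // muln_gt0.
have trW v : v \in G -> tr v \in powerset W.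
  by move=> _; rewrite powersetE; apply/subsetP => a; rewrite inE => /andP[].
have [S SW hS] := pigeonhole_fiber trW Glarge.
pose C := subset_of_card t [set v in G | tr v == S].
have CS v : v \in C -> v \in G /\ tr v = S.
  by move/(subsetP (subset_of_cardS _ _)); rewrite inE => /andP[? /eqP].
have cardC : #|C| = t by apply: card_subset_of_card; exact: ltnW.
have [v0 v0C] : exists v, v \in C by apply/set0Pn; rewrite -card_gt0 cardC.
have [v0G v0S] := CS _ v0C.
have SA A : A \in ps -> t <= #|A :&: S|.
  by move: v0G; rewrite inE v0S => /andP[_ /allP]; apply.
pose sub A := subset_of_card t (A :&: S).
have subA A : sub A \subset A :&: S by exact: subset_of_cardS.
exists (C :: map sub ps); split.
- by rewrite /= size_map.
- rewrite /= /is_part cardC eqxx andbT; apply/andP; split.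
    by apply/subsetP => v /CS[]; rewrite inE => /andP[].
  apply/allP => A' /mapP[A Aps ->]; rewrite card_subset_of_card ?SA // eqxx andbT.
  apply: subset_trans (subA A) _; apply: subset_trans (subsetIl _ _) _.
  by have /allP/(_ A Aps)/andP[] := Pps.
- rewrite /=; apply/andP; split.
    apply/allP => A' /mapP[A Aps ->]; apply/complete_betweenP => x y xC.
    move=> /(subsetP (subA A)); rewrite inE => /andP[_].
    by have [_ <-] := CS x xC; rewrite inE Esym => /andP[_]; rewrite Esym => ->.
  rewrite pairwise_map; apply: sub_pairwise Cps => A B /complete_betweenP h.
  apply/complete_betweenP => x y /(subsetP (subA A)) xA /(subsetP (subA B)) yB.
  by apply: h; [case/setIP: xA | case/setIP: yB].
Qed.

End CompletePartite.

Lemma complete_partite_min_degree (p q r : nat) : 0 < q -> r.-1 * q < r * p ->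
  forall j t, j <= r -> 0 < t -> exists N, forall (V : finType) (E : rel V) (U : {set V}),
    symmetric E -> irreflexive E -> N <= #|U| ->
    (forall a, a \in U -> p * (2 * #|U| - 1) <= 2 * q * degree_in E U a) ->
  exists ps, [/\ size ps = j.+1, all (is_part U t) ps & pairwise (complete_between E) ps].
Proof.
move=> q0 pqr; elim=> [|j IH] t jr t0.
  exists t => V E U _ _ tU _; exists [:: subset_of_card t U]; split=> //=.
  by rewrite /is_part subset_of_cardS card_subset_of_card ?eqxx.
have T0 : 0 < 2 * q * t by rewrite !muln_gt0 q0.
have [N HN] := IH _ (ltnW jr) T0.
exists (N + (r * p + 2 * q * (t * 2 ^ (r * (2 * q * t))).+1)) => V E U Es Ei UN degU.
have [|ps [sps Pps Cps]] := HN V E U Es Ei _ degU; first by lia.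
have [||ps' [sps' Pps' Cps']] := complete_partite_step Es Ei t0 q0 pqr _ degU Pps Cps.
- by rewrite sps.
- by lia.
- by exists ps'; split=> //; rewrite sps' sps.
Qed.

Definition pairs_in (V : finType) (E : rel V) (U : {set V}) := \sum_(x in U) degree_in E U x.

Lemma pairs_inD1 (V : finType) (E : rel V) (U : {set V}) v :
    symmetric E -> irreflexive E -> v \in U ->
  pairs_in E U = pairs_in E (U :\ v) + 2 * degree_in E U v.
Proof.
move=> Es Ei vU; rewrite /pairs_in (big_setD1 v) //=.
rewrite (eq_bigr (fun x => degree_in E (U :\ v) x + E v x)) => [|x xU].
  rewrite big_split /= addnCA; congr addn.
  suff -> : \sum_(x in U :\ v) E v x = degree_in E U v by rewrite addnn mul2n.
  rewrite /degree_in -sum1_card (big_mkcond (fun x => x \in [set y in U | E v y])) /=.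
  rewrite big_mkcond /=; apply: eq_bigr => x _; rewrite !inE.
  by have [->|_] := eqVneq x v; rewrite /= ?Ei ?andbF //; case: (x \in U); case: (E v x).
rewrite /degree_in (cardsD1 v) inE vU Es addnC; congr (_ + _).
by apply: eq_card => y; rewrite !inE andbA.
Qed.

(** A set maximising [Phi], that is [q] times the adjacent ordered pairs minus [p |U|^2], has large
    minimum degree: deleting a vertex does not increase [Phi], which is the bound with [2 |U| - 1].
    The extra [n^2] in the density makes [Phi] at least [|V|^2], so the maximiser is large. *)
Lemma erdos_stone (p q r t : nat) : 0 < q -> 0 < t -> r.-1 * q < r * p ->
  exists N, forall (V : finType) (E : rel V), symmetric E -> irreflexive E ->
    N <= #|V| -> p.+1 * (#|V| * #|V|) <= q * pairs_in E [set: V] ->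
  exists ps, [/\ size ps = r.+1, all (fun A : {set V} => #|A| == t) ps
    & pairwise (complete_between E) ps].
Proof.
move=> q0 t0 pqr; have [N HN] := complete_partite_min_degree q0 pqr (leqnn r) t0.
exists (q * N.+1) => V E Es Ei VN dense.
pose Phi (U : {set V}) := (q%:Z * (pairs_in E U)%:Z - p%:Z * (#|U|%:Z * #|U|%:Z))%R.
have [U _ Umax] : exists2 U : {set V}, true & forall U', (Phi U' <= Phi U)%R.
  have [/= U _ h] := Order.TotalTheory.arg_maxP Phi (erefl (xpredT set0)).
  by exists U => // U'; exact: h.
have UV := Umax setT.
have pU : pairs_in E U <= #|U| * #|U|.
  rewrite -sum_nat_const; apply: leq_sum => x _.
  by apply: subset_leq_card; apply/subsetP => y; rewrite inE => /andP[].
have UN : N <= #|U|.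
  rewrite leqNgt; apply/negP => UN.
  have h0 : (#|V|%:Z * #|V|%:Z <= Phi U)%R.
    by apply: le_trans UV; rewrite /Phi cardsT; lia.
  have h1 : (#|V| * #|V| <= q * (#|U| * #|U|)).
    have : q * pairs_in E U <= q * (#|U| * #|U|) by rewrite leq_mul2l pU orbT.
    by move: h0; rewrite /Phi; lia.
  have h2 := leq_mul VN VN.
  have h3 : #|U| * #|U| <= N.+1 * N.+1 by apply: leq_mul; lia.
  have h4 : q * (#|U| * #|U|) < q * (N.+1 * N.+1).
    by rewrite ltn_pmul2l // ltn_mul //; lia.
  have h5 : q * (N.+1 * N.+1) <= q * N.+1 * (q * N.+1).
    have -> : q * N.+1 * (q * N.+1) = q * (q * (N.+1 * N.+1)) by ring.
    by rewrite leq_mul2l leq_pmull ?orbT.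
  by lia.
have degU a : a \in U -> p * (2 * #|U| - 1) <= 2 * q * degree_in E U a.
  move=> aU; have := Umax (U :\ a); rewrite /Phi (pairs_inD1 Es Ei aU).
  have -> : #|U| = #|U :\ a|.+1 by rewrite (cardsD1 a) aU.
  move: (pairs_in _ _) (degree_in _ _ _) #|U :\ a| => x d u h.
  have -> : 2 * u.+1 - 1 = 2 * u + 1 by lia.
  have E1 : (u.+1%:Z * u.+1%:Z = u%:Z * u%:Z + 2 * u%:Z + 1)%R by rewrite -addn1 PoszD; ring.
  rewrite E1 in h.
  have h' : (p%:Z * (2 * u%:Z + 1) <= 2 * q%:Z * d%:Z)%R.
    have E2 : (q%:Z * (x + 2 * d)%N%:Z = q%:Z * x%:Z + 2 * q%:Z * d%:Z)%R.
      by rewrite PoszD PoszM; ring.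
    by rewrite E2 in h; lia.
  by lia.
have [ps [sps Pps Cps]] := HN V E U Es Ei UN degU.
exists ps; split=> //; apply: sub_all Pps => A /andP[]//.
Qed.

Definition cliqueb (V : finType) (E : rel V) (K : {set V}) :=
  [forall x in K, forall y in K, (x != y) ==> E x y].

Lemma cliqueP (V : finType) (E : rel V) (K : {set V}) :
  reflect (forall x y, x \in K -> y \in K -> x != y -> E x y) (cliqueb E K).
Proof.
apply: (iffP forall_inP) => [h x y xK yK xy|h x xK].
  by have /forall_inP/(_ y yK)/implyP/(_ xy) := h x xK.
by apply/forall_inP => y yK; apply/implyP; exact: h.
Qed.

Lemma cliqueS (V : finType) (E : rel V) (K K' : {set V}) :
  K' \subset K -> cliqueb E K -> cliqueb E K'.
Proof.
move=> /subsetP s /cliqueP h; apply/cliqueP => x y /s xK /s yK; exact: h.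
Qed.

Lemma ramsey a b : exists N, forall (V : finType) (E : rel V) (S : {set V}),
  symmetric E -> N <= #|S| -> exists2 K : {set V}, K \subset S &
    (#|K| = a /\ cliqueb E K) \/ (#|K| = b /\ cliqueb (fun x y => ~~ E x y) K).
Proof.
have empty (V : finType) (E : rel V) : cliqueb E set0.
  by apply/cliqueP => x y; rewrite inE.
move: {2}(a + b) (leqnn (a + b)) => n; elim: n a b => [|n IH] [|a] [|b] abn //;
  try by exists 0 => V E S _ _; exists set0; rewrite ?sub0set // cards0; (by left) || by right.
have [N1 H1] := IH a b.+1 ltac:(lia); have [N2 H2] := IH a.+1 b ltac:(lia).
exists (N1 + N2).+1 => V E S Es hS.
have /card_gt0P[v vS] : 0 < #|S| by lia.
pose S1 := [set x in S :\ v | E v x]; pose S2 := [set x in S :\ v | ~~ E v x].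
have cS : #|S| = (#|S1| + #|S2|).+1.
  rewrite (cardsD1 v) vS add1n; congr _.+1.
  rewrite -!sum1_card (bigID (E v)) /=; congr addn; apply: eq_bigl => x; by rewrite !inE.
have ext (F : rel V) (K S' : {set V}) : symmetric F -> K \subset S' -> S' \subset S :\ v ->
    (forall x, x \in S' -> F v x) -> cliqueb F K ->
    [/\ v |: K \subset S, #|v |: K| = #|K|.+1 & cliqueb F (v |: K)].
  move=> Fs KS' S'S vF KF; split.
  - by rewrite subUset sub1set vS (subset_trans KS') // (subset_trans S'S) // subsetDl.
  - rewrite cardsU1 (_ : v \notin K) //; apply/negP => /(subsetP KS')/(subsetP S'S).
    by rewrite !inE eqxx.
  - apply/cliqueP => x y /setU1P[->|xK] /setU1P[->|yK] xy.
    + by rewrite eqxx in xy.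
    + by apply: vF; exact: (subsetP KS').
    + by rewrite Fs; apply: vF; exact: (subsetP KS').
    + by move/cliqueP: KF; apply.
have [h|h] : N1 <= #|S1| \/ N2 <= #|S2| by lia.
- have [K KS1 KP] := H1 V E S1 Es h.
  have S1S : S1 \subset S :\ v by apply/subsetP => x; rewrite inE => /andP[].
  case: KP => [[Ka Kc]|[Kb Ki]].
    have [|e1 e2 e3] := ext E K S1 Es KS1 S1S _ Kc; first by move=> x; rewrite inE => /andP[].
    by exists (v |: K) => //; left; rewrite e2 Ka.
  by exists K; [rewrite (subset_trans KS1) // (subset_trans S1S) // subsetDl | right].
- have [K KS2 KP] := H2 V E S2 Es h.
  have S2S : S2 \subset S :\ v by apply/subsetP => x; rewrite inE => /andP[].
  case: KP => [[Ka Kc]|[Kb Ki]].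
    by exists K; [rewrite (subset_trans KS2) // (subset_trans S2S) // subsetDl | left].
  have [||e1 e2 e3] := ext (fun x y => ~~ E x y) K S2 _ KS2 S2S _ Ki.
  + by move=> x y; rewrite Es.
  + by move=> x; rewrite inE => /andP[].
  by exists (v |: K) => //; right; rewrite e2 Kb.
Qed.

(** Fix [2 s] vertices of [B]. By pigeonhole [s] vertices of [A] have the same neighbours among
    them, and these neighbours or the remaining vertices number at least [s]. *)
Lemma bipartite_ramsey s : exists N, forall (V : finType) (E : rel V) (A B : {set V}),
  N <= #|A| -> N <= #|B| -> exists A' B' : {set V},
    [/\ A' \subset A, B' \subset B, #|A'| = s, #|B'| = s &
      (forall x y, x \in A' -> y \in B' -> E x y) \/
      (forall x y, x \in A' -> y \in B' -> ~~ E x y)].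
Proof.
exists (2 * s + (s * 2 ^ (2 * s)).+1) => V E A B hA hB.
pose B0 := subset_of_card (2 * s) B.
have cB0 : #|B0| = 2 * s by apply: card_subset_of_card; lia.
pose tr x := [set y in B0 | E x y].
have trB x : x \in A -> tr x \in powerset B0.
  by move=> _; rewrite powersetE; apply/subsetP => y; rewrite inE => /andP[].
have big : s * #|powerset B0| < #|A| by rewrite card_powerset cB0; lia.
have [S /[!powersetE] SB hS] := pigeonhole_fiber trB big.
pose A' := subset_of_card s [set x in A | tr x == S].
have A'P x : x \in A' -> x \in A /\ tr x = S.
  by move/(subsetP (subset_of_cardS _ _)); rewrite inE => /andP[? /eqP].
have cA' : #|A'| = s by apply: card_subset_of_card; exact: ltnW.
have A'A : A' \subset A by apply/subsetP => x /A'P[].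
have [sS|sS] := leqP s #|S|.
- exists A', (subset_of_card s S); split=> //.
  + by rewrite (subset_trans (subset_of_cardS _ _)) // (subset_trans SB) // subset_of_cardS.
  + exact: card_subset_of_card.
  + left=> x y /A'P[_ <-] /(subsetP (subset_of_cardS _ _)).
    by rewrite inE => /andP[].
- have sS' : s <= #|B0 :\: S| by rewrite cardsD (setIidPr SB) cB0; lia.
  exists A', (subset_of_card s (B0 :\: S)); split=> //.
  + rewrite (subset_trans (subset_of_cardS _ _)) // (subset_trans (subsetDl _ _)) //.
    exact: subset_of_cardS.
  + exact: card_subset_of_card.
  + right=> x y /A'P[_ <-] /(subsetP (subset_of_cardS _ _)).
    by rewrite in_setD => /andP[+ yB0]; rewrite in_set yB0.
Qed.

(** * Graphs of intermediate density *)

Definition adj (V : finType) (E : {set {set V}}) : rel V :=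
  fun x y => (x != y) && ([set x; y] \in E).

Definition nonadj (V : finType) (E : {set {set V}}) : rel V :=
  fun x y => (x != y) && ([set x; y] \notin E).

Section InducedEdges.

Variables (V : finType) (E : {set {set V}}).
Hypothesis simpleE : simple_graph E.

Lemma adj_sym : symmetric (adj E).
Proof. by move=> x y; rewrite /adj eq_sym setUC. Qed.

Lemma adj_irr : irreflexive (adj E).
Proof. by move=> x; rewrite /adj eqxx. Qed.

Lemma nonadj_sym : symmetric (nonadj E).
Proof. by move=> x y; rewrite /nonadj eq_sym setUC. Qed.

Lemma nonadj_irr : irreflexive (nonadj E).
Proof. by move=> x; rewrite /nonadj eqxx. Qed.

Lemma card_edge X : X \in E -> #|X| = 2.
Proof. by move=> XE; have /forall_inP/(_ X XE)/eqP := simpleE. Qed.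

Lemma eq_card_induced (A : {set V}) (D : {set {set V}}) :
    (forall x y, x \in A -> y \in A -> x != y -> adj E x y = ([set x; y] \in D)) ->
    (forall X, X \in D -> (X \subset A) && (#|X| == 2)) ->
  #|induced_edges E A| = #|D|.
Proof.
move=> h DA; congr #|pred_of_set _|; apply/setP => X; rewrite inE.
apply/andP/idP => [[XE XA]|XD].
  have /eqP/cards2P[x [y [xy EX]]] := card_edge XE.
  have xA : x \in A by apply: (subsetP XA); rewrite EX !inE eqxx.
  have yA : y \in A by apply: (subsetP XA); rewrite EX !inE eqxx orbT.
  by rewrite EX -h // /adj xy -EX.
have /andP[XA /cards2P[x [y [xy EX]]]] := DA X XD.
have xA : x \in A by apply: (subsetP XA); rewrite EX !inE eqxx.
have yA : y \in A by apply: (subsetP XA); rewrite EX !inE eqxx orbT.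
by split=> //; move: XD; rewrite {1}EX -h // => /andP[_]; rewrite -EX.
Qed.

Lemma set2_subset (x y : V) (A : {set V}) : ([set x; y] \subset A) = (x \in A) && (y \in A).
Proof. by rewrite subUset !sub1set. Qed.

Definition pairs2 (A : {set V}) : {set {set V}} := [set X : {set V} | X \subset A & #|X| == 2].

Lemma in_pairs2 x y A : x != y -> ([set x; y] \in pairs2 A) = (x \in A) && (y \in A).
Proof. by move=> xy; rewrite inE set2_subset cards2 xy andbT. Qed.

Lemma pairs2_sub (A B X : {set V}) : A \subset B -> X \in pairs2 A -> (X \subset B) && (#|X| == 2).
Proof. by move=> AB; rewrite inE => /andP[XA ->]; rewrite (subset_trans XA). Qed.

Lemma card_clique_isolated (A B : {set V}) : cliqueb (adj E) A ->
    cliqueb (fun x y => ~~ adj E x y) B ->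
    (forall x y, x \in A -> y \in B -> ~~ adj E x y) ->
  #|induced_edges E (A :|: B)| = 'C(#|A|, 2).
Proof.
move=> /cliqueP hA /cliqueP hB hAB; rewrite -cards_draws -/(pairs2 A).
apply: eq_card_induced => [x y|X]; last exact/pairs2_sub/subsetUl.
move=> /setUP hx /setUP hy xy; rewrite in_pairs2 //.
have [xA|xA] := boolP (x \in A); have [yA|yA] := boolP (y \in A) => /=.
- by rewrite hA.
- by case: hy yA => [->//|yB] _; apply/negbTE/hAB.
- by case: hx xA => [->//|xB] _; rewrite adj_sym; apply/negbTE/hAB.
- by case: hx xA hy yA => [->//|xB] _ [->//|yB] _; apply/negbTE/hB.
Qed.

Lemma card_clique_join (A B : {set V}) : [disjoint A & B] -> cliqueb (adj E) A ->
    cliqueb (fun x y => ~~ adj E x y) B ->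
    (forall x y, x \in A -> y \in B -> adj E x y) ->
  #|induced_edges E (A :|: B)| = 'C(#|A| + #|B|, 2) - 'C(#|B|, 2).
Proof.
move=> dAB /cliqueP hA /cliqueP hB hAB.
have cAB : #|A :|: B| = #|A| + #|B| by rewrite cardsU (disjoint_setI0 dAB) cards0 subn0.
have BAB : pairs2 B \subset pairs2 (A :|: B).
  by apply/subsetP => X XB; rewrite inE (pairs2_sub _ XB) ?subsetUr.
rewrite (eq_card_induced (D := pairs2 (A :|: B) :\: pairs2 B)).
- by rewrite cardsD (setIidPr BAB) !cards_draws cAB.
- move=> x y xAB yAB xy; rewrite in_setD !in_pairs2 // xAB yAB andbT.
  have [xB|xB] := boolP (x \in B); have [yB|yB] := boolP (y \in B) => /=.
  + by apply/negbTE/hB.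
  + by rewrite adj_sym hAB //; move: yAB; rewrite inE (negbTE yB) orbF.
  + by rewrite hAB //; move: xAB; rewrite inE (negbTE xB) orbF.
  + by apply: hA => //; [move: xAB | move: yAB]; rewrite inE ?(negbTE xB) ?(negbTE yB) orbF.
- by move=> X; rewrite inE => /andP[_]; rewrite inE.
Qed.

Lemma card_bipartite_join (A B : {set V}) : [disjoint A & B] ->
    cliqueb (fun x y => ~~ adj E x y) A -> cliqueb (fun x y => ~~ adj E x y) B ->
    (forall x y, x \in A -> y \in B -> adj E x y) ->
  #|induced_edges E (A :|: B)| = #|A| * #|B|.
Proof.
move=> dAB /cliqueP hA /cliqueP hB hAB.
have cAB : #|A :|: B| = #|A| + #|B| by rewrite cardsU (disjoint_setI0 dAB) cards0 subn0.
have sub (C : {set V}) : C \subset A :|: B -> pairs2 C \subset pairs2 (A :|: B).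
  by move=> CAB; apply/subsetP => X XC; rewrite inE (pairs2_sub CAB XC).
have dP : [disjoint pairs2 A & pairs2 B].
  rewrite -setI_eq0; apply/eqP/setP => X; rewrite !inE; apply/negP.
  move=> /andP[/andP[XA /eqP X2] /andP[XB _]].
  have /card_gt0P[x xX] : 0 < #|X| by rewrite X2.
  by have := disjointFr dAB (subsetP XA x xX); rewrite (subsetP XB x xX).
rewrite (eq_card_induced (D := pairs2 (A :|: B) :\: (pairs2 A :|: pairs2 B))).
- have s : pairs2 A :|: pairs2 B \subset pairs2 (A :|: B).
    by rewrite subUset !sub ?subsetUl ?subsetUr.
  rewrite cardsD (setIidPr s) cardsU (disjoint_setI0 dP) cards0 subn0 !cards_draws cAB.
  have := bin2E (#|A| + #|B|); have := bin2E #|A|; have := bin2E #|B|.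
  move: #|A| #|B| => a b; rewrite mulnDr !mulnDl (mulnC b a).
  by move: ('C(a + b, 2)) ('C(a, 2)) ('C(b, 2)) (a * a) (b * b) (a * b); lia.
- move=> x y xAB yAB xy; rewrite in_setD in_setU !in_pairs2 // xAB yAB andbT.
  have BA z : z \in A :|: B -> z \notin A -> z \in B by rewrite inE => /orP[->|].
  have nAB z : z \in A -> (z \in B) = false by exact: disjointFr dAB.
  have [xA|xA] := boolP (x \in A); have [yA|yA] := boolP (y \in A) => /=.
  + by rewrite (negbTE (hA _ _ xA yA xy)).
  + by rewrite nAB //= hAB // BA.
  + by rewrite [y \in B]nAB // andbF /= adj_sym hAB // BA.
  + by rewrite (BA x) // (BA y) //=; apply/negbTE/hB => //; exact: BA.
- by move=> X; rewrite inE => /andP[_]; rewrite inE.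
Qed.

Lemma induced_disjoint_union (A B : {set V}) :
    (forall x y, x \in A -> y \in B -> nonadj E x y) ->
  #|induced_edges E (A :|: B)| = #|induced_edges E A| + #|induced_edges E B| /\
  #|A :|: B| = #|A| + #|B|.
Proof.
move=> hAB.
have dAB : A :&: B = set0.
  by apply/setP => x; rewrite !inE; apply/negP => /andP[xA /(hAB x x xA)]; rewrite nonadj_irr.
split; last by rewrite cardsU dAB cards0 subn0.
have -> : induced_edges E (A :|: B) = induced_edges E A :|: induced_edges E B.
  apply/setP => X; rewrite !inE -andb_orr; apply: andb_id2l => XE.
  apply/idP/orP => [XAB|[XA|XB]]; last 2 first.
  - by rewrite (subset_trans XA) ?subsetUl.
  - by rewrite (subset_trans XB) ?subsetUr.
  have /eqP/cards2P[x [y [xy EX]]] := card_edge XE.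
  move: XAB XE; rewrite EX !set2_subset !inE => /andP[/orP[xA|xB] /orP[yA|yB]] XE.
  - by left; rewrite xA yA.
  - by have := hAB x y xA yB; rewrite /nonadj XE andbF.
  - by have := hAB y x yA xB; rewrite nonadj_sym /nonadj XE andbF.
  - by right; rewrite xB yB.
rewrite cardsU (_ : _ :&: _ = set0) ?cards0 ?subn0 //.
apply/setP => X; rewrite !inE; apply/negP => /andP[/andP[XE XA] /andP[_ XB]].
have /card_gt0P[x xX] : 0 < #|X| by rewrite card_edge.
by move/setP/(_ x): dAB; rewrite !inE (subsetP XA) // (subsetP XB).
Qed.

Lemma disjoint_cliques (M : nat) (ps : seq {set V}) (xs : seq nat) :
    size xs = size ps -> all (fun x => x <= M) xs ->
    all (fun A : {set V} => (M <= #|A|) && cliqueb (adj E) A) ps ->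
    pairwise (complete_between (nonadj E)) ps ->
  exists A : {set V}, [/\ A \subset \bigcup_(B <- ps) B, #|A| = \sum_(x <- xs) x &
    #|induced_edges E A| = \sum_(x <- xs) 'C(x, 2)].
Proof.
elim: ps xs => [|B ps IH] [|x xs] //=.
  move=> _ _ _ _; exists set0; rewrite !big_nil sub0set cards0; split=> //.
  apply/eqP; rewrite cards_eq0; apply/eqP/setP => X; rewrite !inE subset0.
  by apply/negP => /andP[/card_edge + /eqP EX]; rewrite EX cards0.
move=> [sz] /andP[xM xsM] /andP[/andP[MB Bc] psc] /andP[/allP BC pw].
have [A [AU Ac Ae]] := IH xs sz xsM psc pw.
have [|e1 e2] := @induced_disjoint_union (subset_of_card x B) A.
  move=> y z /(subsetP (subset_of_cardS _ _)) yB /(subsetP AU).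
  rewrite big_seq; elim/big_ind: _ => [|C C' hC hC'|C Cps]; first by rewrite inE.
  + by rewrite inE => /orP[/hC|/hC'].
  + by move=> zC; have /complete_betweenP/(_ y z yB zC)[] := BC C Cps.
have cx : #|subset_of_card x B| = x by apply: card_subset_of_card; exact: leq_trans MB.
exists (subset_of_card x B :|: A); rewrite !big_cons e1 e2 Ac Ae cx; split=> //.
- apply: setUSS => //; exact: subset_of_cardS.
- congr addn; rewrite -[in RHS]cx -cards_draws -/(pairs2 _).
  apply: eq_card_induced => [y z yB zB yz|X]; last exact: pairs2_sub.
  rewrite in_pairs2 // yB zB; have /cliqueP := cliqueS (subset_of_cardS x B) Bc; exact.
Qed.

Lemma pairs_in_adj : pairs_in (adj E) [set: V] = 2 * #|E|.
Proof.
have -> : 2 * #|E| = \sum_(X in E) #|X|.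
  by rewrite (eq_bigr (fun=> 2)) ?sum_nat_const 1?mulnC // => X /card_edge.
under [RHS]eq_bigr => X _ do rewrite -sum1_card big_mkcond.
rewrite exchange_big /pairs_in; apply: eq_big => [x|x _]; first by rewrite inE.
rewrite -big_mkcondr /= sum1_card /degree_in.
have inj : {in [set y in [set: V] | adj E x y] &, injective (fun y => [set x; y])}.
  move=> y z; rewrite !inE /= => /andP[xy _] /andP[xz _] /setP/(_ y).
  by rewrite !inE eqxx orbT eq_sym (negbTE xy) /= => /esym/eqP.
rewrite -(card_in_imset inj); apply: eq_card => X; rewrite [RHS]unfold_in.
apply/imsetP/andP => [[y]|[XE xX]].
  by rewrite !inE /= => /andP[xy xyE] ->; rewrite !inE eqxx.
have /eqP/cards2P[a [b [ab EX]]] := card_edge XE.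
move: xX; rewrite EX !inE => /orP[/eqP xa|/eqP xb].
- by exists b; rewrite ?inE /adj xa ?ab -?EX.
- by exists a; rewrite ?inE /adj xb 1?eq_sym 1?setUC ?ab -?EX.
Qed.

Lemma pairs_in_nonadj : pairs_in (nonadj E) [set: V] + 2 * #|E| + #|V| = #|V| * #|V|.
Proof.
rewrite -pairs_in_adj /pairs_in -big_split /= -[X in _ + X = _]cardsT -sum1_card.
rewrite -big_split /= -[in RHS]cardsT -sum_nat_const; apply: eq_bigr => x _.
rewrite /degree_in -!sum1_card.
rewrite [RHS](bigD1 x) ?inE //= addnC; congr addn.
rewrite [RHS](bigID (fun y => [set x; y] \in E)) addnC /=.
by congr addn; apply: eq_bigl => y; rewrite !inE /= eq_sym.
Qed.

End InducedEdges.

Lemma arrow_middle (m f r a b c : nat) : 0 < m -> 0 < r ->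
    f = 'C(a, 2) -> (f%:Z = 'C(m, 2)%:Z - 'C(b, 2)%:Z)%R ->
    (f%:Z = c%:Z * (m%:Z - c%:Z))%R -> 0 < c ->
    a <= m -> b <= m -> sum_of_binomials m f r.+1 ->
  forall q, 0 < q -> exists N, forall n e, N <= n -> n * n <= q * e ->
    q * r * (2 * e) + r * (n * n) <= q * (n * n) -> arrow n e m f.
Proof.
move=> m0 r0 fa fb fc c0 am bm [x [x1 xm xf]] q q0.
have cm : c <= m by nia.
have [NB HB] := bipartite_ramsey m.
(* A clique and an independent set share at most one vertex; the summand 1 allows for deleting it
   before bipartite Ramsey is applied. *)
pose M := (NB + m).+1.
have [NR HR] := ramsey M M.
have [N1 H1] := @erdos_stone 1 q 1 NR.+1 q0 (ltn0Sn _) isT.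
have q'0 : 0 < 4 * r * q by rewrite !muln_gt0 r0.
(* The density used in the complement is [(r - 1) / r + 1 / (4 r q)], just above that of the
   [r]-partite Turan graph. The assumed gap [1 / q] covers this excess, the additional [n^2] asked
   by [erdos_stone], and the diagonal pairs once [n >= 2 r q]. *)
have pq' : r.-1 * (4 * r * q) < r * (4 * r.-1 * q).+1.
  have -> : r * (4 * r.-1 * q).+1 = r + r.-1 * (4 * r * q) by rewrite -addn1; ring.
  by lia.
have [N2 H2] := @erdos_stone (4 * r.-1 * q).+1 (4 * r * q) r NR.+1 q'0 (ltn0Sn _) pq'.
exists (N1 + N2 + 2 * r * q) => n e hn dense sparse.
apply/forallP => E; apply/implyP => /andP[sE /eqP Ee].
suff [A Am Af] : exists2 A : {set 'I_n}, #|A| = m & #|induced_edges E A| = f.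
  by apply/existsP; exists A; rewrite Am Af !eqxx.
have pick s (A : {set 'I_n}) : s <= #|A| -> exists2 B : {set 'I_n}, B \subset A & #|B| = s.
  by move=> sA; exists (subset_of_card s A); rewrite ?subset_of_cardS ?card_subset_of_card.
have join (K I : {set 'I_n}) : cliqueb (adj E) K -> cliqueb (fun x y => ~~ adj E x y) I ->
    m <= #|K| -> m <= #|I| -> (forall x y, x \in K -> y \in I -> adj E x y) ->
    exists2 A : {set 'I_n}, #|A| = m & #|induced_edges E A| = f.
  move=> cK cI mK mI h.
  have [K' K'K cK'] := pick (m - b) K (leq_trans (leq_subr _ _) mK).
  have [I' I'I cI'] := pick b I (leq_trans bm mI).
  have dis : [disjoint K' & I'].
    rewrite -setI_eq0; apply/eqP/setP => z; rewrite !inE; apply/negP => /andP[zK zI].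
    by have := h z z (subsetP K'K z zK) (subsetP I'I z zI); rewrite adj_irr.
  exists (K' :|: I'); first by rewrite cardsU (disjoint_setI0 dis) cards0 cK' cI'; lia.
  rewrite card_clique_join //.
  - by rewrite cK' cI' subnK //; lia.
  - exact: cliqueS cK.
  - exact: cliqueS cI.
  - by move=> y z /(subsetP K'K) yK /(subsetP I'I) zI; exact: h.
have isolate (K I : {set 'I_n}) : cliqueb (adj E) K -> cliqueb (fun x y => ~~ adj E x y) I ->
    m <= #|K| -> m <= #|I| -> (forall x y, x \in K -> y \in I -> ~~ adj E x y) ->
    [disjoint K & I] ->
    exists2 A : {set 'I_n}, #|A| = m & #|induced_edges E A| = f.
  move=> cK cI mK mI h dis.
  have [K' K'K cK'] := pick a K (leq_trans am mK).
  have [I' I'I cI'] := pick (m - a) I (leq_trans (leq_subr _ _) mI).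
  exists (K' :|: I').
    rewrite cardsU (_ : K' :&: I' = set0) ?cards0 ?cK' ?cI'; first by lia.
    by apply/eqP; rewrite setI_eq0; exact: disjointWl K'K (disjointWr I'I dis).
  rewrite card_clique_isolated ?cK' //.
  - exact: cliqueS cK.
  - exact: cliqueS cI.
  - by move=> y z /(subsetP K'K) yK /(subsetP I'I) zI; exact: h.
have both (K I : {set 'I_n}) : cliqueb (adj E) K -> cliqueb (fun x y => ~~ adj E x y) I ->
    M <= #|K| -> M <= #|I| ->
    exists2 A : {set 'I_n}, #|A| = m & #|induced_edges E A| = f.
  move=> cK cI MK MI.
  have KI1 : #|K :&: I| <= 1.
    rewrite leqNgt; apply/negP => /card_gt1P[y [z [/setIP[yK yI] /setIP[zK zI] yz]]].
    by move/cliqueP/(_ y z yK zK yz): cK; move/cliqueP/(_ y z yI zI yz): cI => /negbTE ->.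
  have hI : NB <= #|I :\: K| by rewrite cardsD setIC; move: MI; rewrite /M; lia.
  have hK : NB <= #|K| by apply: leq_trans MK; rewrite /M; lia.
  have [K' [I' [K'K I'I cK' cI' h]]] := HB _ (adj E) K (I :\: K) hK hI.
  have cK'' := cliqueS K'K cK.
  have cI'' := cliqueS (subset_trans I'I (subsetDl _ _)) cI.
  case: h => h; first by apply: (join K' I') => //; rewrite ?cK' ?cI'.
  apply: (isolate K' I') => //; rewrite ?cK' ?cI' //.
  rewrite -setI_eq0; apply/eqP/setP => z; rewrite !inE; apply/negP => /andP[zK /(subsetP I'I)].
  by rewrite inE (subsetP K'K z zK).
have [ps1 [sz1 /allP c1 pw1]] := H1 _ (adj E) (adj_sym E) (adj_irr E) ltac:(rewrite card_ord; lia)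
  ltac:(rewrite pairs_in_adj // Ee card_ord; lia).
case: ps1 sz1 c1 pw1 => [|A [|B []]] // _ c1 /= /andP[/andP[/complete_betweenP AB _] _].
have cA : NR <= #|A| by rewrite (eqP (c1 A (mem_head _ _))).
have cB : NR <= #|B|.
  by rewrite (eqP (c1 B _)) // !inE eqxx orbT.
have [KA KAA hA] := HR _ (adj E) A (adj_sym E) cA.
have [KB KBB hB] := HR _ (adj E) B (adj_sym E) cB.
have ABadj y z : y \in KA -> z \in KB -> adj E y z.
  by move=> /(subsetP KAA) yA /(subsetP KBB) zB; have [] := AB y z yA zB.
have mM : m <= M by rewrite /M; lia.
have bip : cliqueb (fun x y => ~~ adj E x y) KA -> cliqueb (fun x y => ~~ adj E x y) KB ->
    m <= #|KA| -> m <= #|KB| ->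
    exists2 A : {set 'I_n}, #|A| = m & #|induced_edges E A| = f.
  move=> iA iB mA mB.
  have [A' A'A cA'] := pick c KA (leq_trans cm mA).
  have [B' B'B cB'] := pick (m - c) KB (leq_trans (leq_subr _ _) mB).
  have dis : [disjoint A' & B'].
    rewrite -setI_eq0; apply/eqP/setP => z; rewrite !inE; apply/negP => /andP[zK zI].
    by have := ABadj z z (subsetP A'A z zK) (subsetP B'B z zI); rewrite adj_irr.
  exists (A' :|: B'); first by rewrite cardsU (disjoint_setI0 dis) cards0 cA' cB'; lia.
  rewrite card_bipartite_join //.
  - by rewrite cA' cB'; move: fc; rewrite subzn // -PoszM => -[].
  - exact: cliqueS iA.
  - exact: cliqueS iB.
  - by move=> y z /(subsetP A'A) yA /(subsetP B'B) zB; exact: ABadj.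
have iM (I : {set 'I_n}) : #|I| = M -> m <= #|I| by move=> ->.
have reduce : (forall K : {set 'I_n}, M <= #|K| -> cliqueb (adj E) K ->
    exists2 A : {set 'I_n}, #|A| = m & #|induced_edges E A| = f) ->
    exists2 A : {set 'I_n}, #|A| = m & #|induced_edges E A| = f.
  move=> h.
  case: hA hB => [[mA cKA]|[mA iA]] [[mB cKB]|[mB iB]].
  - by apply: (h KA) => //; rewrite mA.
  - by apply: (join KA KB) => //; exact: iM.
  - by apply: (join KB KA) => //; try exact: iM; move=> y z yB zA; rewrite adj_sym ABadj.
  - by apply: bip => //; exact: iM.
apply: reduce => K MK cK.
have dense2 : (4 * r.-1 * q).+2 * (#|'I_n| * #|'I_n|) <= 4 * r * q * pairs_in (nonadj E) [set: 'I_n].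
  have := pairs_in_nonadj sE; rewrite Ee card_ord.
  have rn : 2 * r * q * n <= n * n by rewrite leq_mul2r; apply/orP; right; lia.
  move: (pairs_in _ _) => P EP.
  have -> : 4 * r * q * P = 4 * r * q * (n * n) - 4 * (q * r * (2 * e)) - 2 * (2 * r * q * n).
    by rewrite -EP; lia.
  have -> : (4 * r.-1 * q).+2 * (n * n) = 4 * r * q * (n * n) - 4 * (q * (n * n)) + 2 * (n * n).
    by case: (r) r0 => // r' _ /=; lia.
  have := sparse; have : q * (n * n) <= r * q * (n * n) by rewrite leq_mul2r leq_pmull ?orbT.
  have : n * n <= r * (n * n) by rewrite leq_pmull.
  move: (n * n) (2 * r * q * n) (q * r * (2 * e)) rn => N' X Y; lia.
have [ps2 [sz2 c2 pw2]] := H2 _ (nonadj E) (nonadj_sym E) (nonadj_irr E)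
  ltac:(rewrite card_ord; lia) dense2.
have [/hasP[P Pps /existsP[I /and3P[IP /eqP cI iI]]]|noI] :=
    boolP (has (fun P : {set 'I_n} => [exists I : {set 'I_n},
      [&& I \subset P, #|I| == M & cliqueb (fun x y => ~~ adj E x y) I]]) ps2).
  by apply: (both K I) => //; rewrite cI.
have [ps3 [sz3 c3 pw3]] : exists ps3 : seq {set 'I_n}, [/\ size ps3 = size ps2,
    all (fun A : {set 'I_n} => (M <= #|A|) && cliqueb (adj E) A) ps3 &
    pairwise (complete_between (nonadj E)) ps3].
  (* The added clause says that any set completely joined to all old parts is so joined to the new
     ones; it carries pairwise completeness through the induction. *)
  suff [ps3 [sz3 c3 pw3 _]] : exists ps3 : seq {set 'I_n}, [/\ size ps3 = size ps2,
      all (fun A : {set 'I_n} => (M <= #|A|) && cliqueb (adj E) A) ps3,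
      pairwise (complete_between (nonadj E)) ps3 &
      forall X : {set 'I_n}, all (complete_between (nonadj E) X) ps2 ->
        all (complete_between (nonadj E) X) ps3] by exists ps3.
  elim: (ps2) c2 pw2 noI {sz2} => [|P ps IH] /=; first by exists [::].
  move=> /andP[/eqP cP cps] /andP[Pps pps]; rewrite negb_or => /andP[noP nops].
  have [ps3 [sz3 c3 pw3 sub3]] := IH cps pps nops.
  have [|Q QP [[cQ kQ]|[cQ iQ]]] := HR _ (adj E) P (adj_sym E); first by rewrite cP.
    have QX (X Y : {set 'I_n}) : Y \subset X -> forall Z, complete_between (nonadj E) X Z ->
        complete_between (nonadj E) Y Z.
      move=> /subsetP YX Z /complete_betweenP h.
      by apply/complete_betweenP => y z /YX yX zZ; exact: h.
    exists (Q :: ps3); split=> /=; rewrite ?sz3 ?c3 ?pw3 ?andbT ?cQ ?leqnn //.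
    - apply: sub3; apply: sub_all Pps; exact: QX.
    - move=> X /andP[/complete_betweenP XP Xps]; rewrite sub3 // andbT.
      apply/complete_betweenP => y z yX /(subsetP QP) zP; exact: XP.
  by move/negP: noP; case; apply/existsP; exists Q; rewrite QP cQ eqxx.
have [||U [_ cU eU]] := @disjoint_cliques _ E sE M ps3 [seq x i | i <- enum 'I_r.+1] _ _ c3 pw3.
- by rewrite size_map size_enum_ord sz3 sz2.
- apply/allP => _ /mapP[i _ ->]; apply: leq_trans mM; rewrite -xm.
  by rewrite (bigD1 i) //= leq_addr.
by exists U; rewrite ?cU ?eU big_map big_enum.
Qed.

(** * The limit *)

(** Two cliques of sizes as equal as possible; the summand 1 pays for odd [n]. *)
Lemma not_arrow_half n m f e : (forall x, x <= m -> f < 'C(x, 2) + 'C(m - x, 2)) ->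
  n * n + 1 <= 2 * (2 * e + n) -> e <= 'C(n, 2) -> ~~ arrow n e m f.
Proof.
move=> fm hn en; apply: (@not_arrow_cobipartite n m f e n./2) => //; first by lia.
rewrite en andbT; have := bin2E n./2; have := bin2E (n - n./2).
have := odd_double_half n; move: hn.
have -> : n * n = (n - n./2 + n./2) * (n - n./2 + n./2) by rewrite subnK //; lia.
case: (odd n) => /= hn.
  move=> En; have -> : n - n./2 = n./2.+1 by lia.
  by move: (n./2) hn En => h; lia.
move=> En; have -> : n - n./2 = n./2 by lia.
by move: (n./2) hn En => h; lia.
Qed.

(** A union of [r] cliques with [e] edges on [n] vertices has sizes with sum [n] and sum of squares
    [2 e + n], which has the parity of [n]. *)
Lemma not_arrow_large m f r : 0 < m -> r = 2 \/ 5 <= r ->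
    (forall s, sum_of_binomials m f s.+1 -> r <= s) ->
    (forall x, x <= m -> f < 'C(x, 2) + 'C(m - x, 2)) ->
  exists n0 C, forall n e, n0 <= n -> e <= 'C(n, 2) ->
    n * n + C <= r * (2 * e + n) -> ~~ arrow n e m f.
Proof.
move=> m0 [-> _|r5 rmin] fm; first by exists 0, 1 => n e _ en h; exact: not_arrow_half.
have [n0 [C sq]] := square_partition_large r5.
exists (n0 + 3), C => n e nn en h.
(* The bound [9 / 16] of the partition theorem exceeds [1 / 2], so above it two balanced cliques
   with added edges already serve. *)
have [le9|gt9] := leqP (16 * (2 * e + n)) (9 * (n * n)); last first.
  apply: not_arrow_half => //; have : 3 * 3 <= n * n by apply: leq_mul; lia.
  by move: (n * n) gt9; lia.
have [||s [sz sn sq']] := sq n (2 * e + n) _ _ h le9; first by lia.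
  by rewrite oddD oddM.
case: r r5 rmin sz {sq h} => // r _ rmin sz.
have [g gs] := colouring_exists sz sn.
apply: (@not_arrow_cliques n r.+1 m f e g) => //.
under eq_bigr => i _ do rewrite gs.
have -> : \sum_(i < r.+1) 'C(nth 0 s i, 2) = \sum_(x <- s) 'C(x, 2).
  by rewrite [RHS](big_nth 0) big_mkord sz.
suff : 2 * e + n = 2 * (\sum_(x <- s) 'C(x, 2)) + n by lia.
rewrite -{1}sq' -sn big_distrr /= -big_split /=; apply: eq_bigr => x _.
by rewrite bin2E.
Qed.

Lemma card_ord_interval K lo hi : hi <= K -> #|[set e : 'I_K | lo <= e < hi]| = hi - lo.
Proof.
move=> hK; have [le|/ltnW le] := leqP hi lo.
  rewrite (eqP (_ : hi - lo == 0)) //; apply/eqP; rewrite cards_eq0; apply/eqP/setP => e.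
  by rewrite !inE; lia.
rewrite -[RHS]card_ord.
have lt (i : 'I_(hi - lo)) : lo + i < K by have := ltn_ord i; lia.
pose h i := Ordinal (lt i).
rewrite -(card_imset _ (_ : injective h)); last first.
  by move=> i j [] /addnI /val_inj.
apply: eq_card => e; rewrite inE; apply/idP/imsetP => [/andP[le1 le2]|[i _ ->]] /=.
  have lt' : e - lo < hi - lo by lia.
  by exists (Ordinal lt') => //; apply: val_inj; rewrite /= subnKC.
by have := ltn_ord i; lia.
Qed.

Lemma leq_card_threshold K (S : {set 'I_K}) d t : 0 < d ->
  (forall e : 'I_K, e \in S -> d * e < t) -> d * #|S| <= t + d.
Proof.
move=> d0 h; have hi : minn (t %/ d).+1 K <= K by exact: geq_minr.
have : #|S| <= #|[set e : 'I_K | 0 <= e < minn (t %/ d).+1 K]|.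
  apply/subset_leq_card/subsetP => e /h et; rewrite inE /= leq_min ltn_ord andbT ltnS.
  by rewrite leq_divRL // mulnC ltnW.
rewrite card_ord_interval // subn0 => le.
have : #|S| <= (t %/ d).+1 by apply: leq_trans le (geq_minl _ _).
rewrite -(leq_pmul2l d0) => le2; apply: leq_trans le2 _.
by have := leq_trunc_div t d; lia.
Qed.

Lemma geq_card_interval K (S : {set 'I_K}) d0 t0 d1 t1 : 0 < d0 -> 0 < d1 ->
    t1 < d1 * K -> (forall e : 'I_K, t0 <= d0 * e -> d1 * e <= t1 -> e \in S) ->
  d0 * t1 <= d0 * d1 * #|S| + d1 * t0 + d0 * d1.
Proof.
move=> d00 d10 tK h.
have hi : (t1 %/ d1).+1 <= K by rewrite ltn_divLR // mulnC.
have : #|[set e : 'I_K | (t0 %/ d0).+1 <= e < (t1 %/ d1).+1]| <= #|S|.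
  apply/subset_leq_card/subsetP => e; rewrite inE ltnS => /andP[le1 le2].
  apply: h; first by rewrite mulnC ltnW // -ltn_divLR.
  by rewrite mulnC -leq_divRL.
rewrite card_ord_interval // => le.
have := ltn_ceil t1 d10; have := leq_trunc_div t0 d0.
move: (t1 %/ d1) (t0 %/ d0) le {hi} => y z le h0 h1.
have : d0 * d1 * y <= d0 * d1 * (#|S| + z) by rewrite leq_mul2l; apply/orP; right; lia.
have : d1 * (z * d0) <= d1 * t0 by rewrite leq_mul2l h0 orbT.
have : d0 * t1 <= d0 * (y.+1 * d1) by rewrite leq_mul2l (ltnW h1) orbT.
lia.
Qed.

(** The two inequalities state that [r u / d] is within [1 / k] of 1, in natural numbers only.
    Convergence follows, hence the value of the limsup. *)
Lemma limn_sup_nat_ratio (R : realType) (u d : nat -> nat) (r : nat) : 0 < r ->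
    (forall k, exists N, forall n, N <= n ->
      [/\ 0 < d n, k * (r * u n) <= k.+1 * d n & k * d n <= k * (r * u n) + d n]) ->
  limn_sup (fun n => (u n)%:R / (d n)%:R : R)%R = (r%:R^-1)%R.
Proof.
move=> r0 h; apply: (cvg_limn_inf_sup _).2; apply/cvgrPdist_le => eps eps0.
have [k keps] : exists k : nat, (eps^-1 <= k.+1%:R)%R.
  by exists (Num.truncn eps^-1); apply/ltW/truncnS_gt.
have [N hN] := h k.+1; exists N => // n /= /hN[d0 h1 h2].
have rR : (0 < r%:R :> R)%R by rewrite ltr0n.
have dR : (0 < (d n)%:R :> R)%R by rewrite ltr0n.
have kR : (0 < k.+1%:R :> R)%R by rewrite ltr0n.
have eps1 : (1 <= k.+1%:R * eps)%R by rewrite -ler_pdivrMr // div1r.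
have r1 : (1 <= r%:R :> R)%R by rewrite ler1n.
have -> : (r%:R^-1 - (u n)%:R / (d n)%:R = ((d n)%:R - r%:R * (u n)%:R) / (r%:R * (d n)%:R) :> R)%R.
  by field; rewrite ?lt0r_neq0.
rewrite normrM normfV [X in (_ / X)%R]gtr0_norm ?mulr_gt0 // ler_pdivrMr ?mulr_gt0 //.
rewrite -(ler_pM2l kR).
apply: (@le_trans _ _ (d n)%:R%R); last first.
  rewrite mulrA [leRHS](_ : _ = (k.+1%:R * eps * r%:R * (d n)%:R)%R); last by ring.
  rewrite ler_peMl ?ler0n //; apply: (le_trans eps1).
  by rewrite ler_peMr // (le_trans ler01).
rewrite -[X in (X * _ <= _)%R]gtr0_norm // -normrM ler_norml mulrBr.
move: h1 h2; rewrite -(ler_nat R) -(ler_nat R (_ * d n)) !natrM natrD !natrM -[k.+2]addn1 natrD mulrDl mul1r => h1 h2.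
by apply/andP; split; lra.
Qed.

Lemma leq_of_leq_bin2 a m : 1 < m -> 'C(a, 2) <= 'C(m, 2) -> a <= m.
Proof.
move=> m1 h; rewrite leqNgt; apply/negP => ma.
have : 'C(m.+1, 2) <= 'C(a, 2) by exact: leq_bin2l.
by rewrite binS bin1; lia.
Qed.

Theorem theorem1p5 (R : realType) (m f r : nat) (hm : 2 <= m)
  (habc : exists a b c : nat,
     [/\ [/\ 0 < a, 0 < b & 0 < c],
         f = 'C(a, 2),
         (f%:Z = 'C(m, 2)%:Z - 'C(b, 2)%:Z)%R
       & (f%:Z = c%:Z * (m%:Z - c%:Z))%R])
  (hr : sum_of_binomials m f r.+1)
  (hr_min : forall s : nat, sum_of_binomials m f s.+1 -> r <= s)
  (hr_val : r = 2 \/ 5 <= r) :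
  sigma R m f = (1 / r%:R)%R.
Proof.
have [a [b [c [[a0 b0 c0] fa fb fc]]]] := habc.
have m0 : 0 < m by lia.
have r2 : 2 <= r by case: hr_val => [->|]; lia.
have two_cliques := lt_two_cliques hm a0 b0 c0 fa fb fc.
have {two_cliques} fm : forall x, x <= m -> f < 'C(x, 2) + 'C(m - x, 2).
  by apply: two_cliques => /hr_min; lia.
have am : a <= m by apply: leq_of_leq_bin2 => //; rewrite -fa; lia.
have bm : b <= m by apply: leq_of_leq_bin2 => //; lia.
have [n0 [C large]] := not_arrow_large m0 hr_val hr_min fm.
rewrite /sigma div1r.
apply: (@limn_sup_nat_ratio R (fun n => #|S_set n m f|) (fun n => 'C(n, 2))); first by lia.
case=> [|k].
  by exists 2 => n n2; rewrite bin_gt0 n2; split=> //; rewrite mul0n.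
(* Both ends of the middle range together lose [3 n^2 / (2 q)] values of [e]. With this [q] and
   [K = k + 1] the loss is [n^2 / (8 r K)], which is the term [n^2] in [low] after multiplication by
   [8 r K]. *)
have q0 : 0 < 12 * r * k.+1 by rewrite !muln_gt0; lia.
have [N middle] := arrow_middle m0 (ltnW r2) fa fb fc c0 am bm hr q0.
exists (N + n0 + (k.+1 * (2 * C + 8 * r)).+2) => n nN.
have En := bin2E n.
have n2 : 2 <= n by lia.
have big : n * (k.+1 * (2 * C + 8 * r)).+1 + n <= n * n.
  by rewrite -mulnSr leq_mul2l; apply/orP; right; lia.
have up : 2 * r * #|S_set n m f| <= n * n + C + 2 * r.
  apply: leq_card_threshold => [|e]; first by lia.
  rewrite inE => arr; rewrite ltnNge; apply: contraL arr => ge.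
  apply: large; [lia|by have := ltn_ord e; rewrite ltnS|lia].
have low : 4 * k.+1 * (n * n) <= 8 * k.+1 * (r * #|S_set n m f|) + n * n + 8 * k.+1 * r.
  have rq : r <= 12 * r * k.+1 by lia.
  have qr : 0 < 2 * (12 * r * k.+1) * r by rewrite !muln_gt0; lia.
  have := @geq_card_interval _ (S_set n m f) (12 * r * k.+1) (n * n) (2 * (12 * r * k.+1) * r)
    ((12 * r * k.+1 - r) * (n * n)) q0 qr.
  have small : (12 * r * k.+1 - r) * (n * n) < 2 * (12 * r * k.+1) * r * ('C(n, 2)).+1.
    apply: (@leq_ltn_trans (12 * r * k.+1 * (n * n))); first by rewrite leq_mul2r leq_subr orbT.
    have -> : 2 * (12 * r * k.+1) * r * ('C(n, 2)).+1 = 12 * r * k.+1 * (2 * (r * ('C(n, 2)).+1)).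
      by ring.
    rewrite ltn_pmul2l //.
    have : 2 * ('C(n, 2)).+1 <= r * ('C(n, 2)).+1 by rewrite leq_mul2r r2.
    have : 2 * n <= n * n by rewrite leq_mul2r n2 orbT.
    lia.
  move=> /(_ small) low.
  have {low} : (12 * r * k.+1 - r) * (n * n) <=
      2 * (12 * r * k.+1) * r * #|S_set n m f| + 2 * r * (n * n) + 2 * (12 * r * k.+1) * r.
    rewrite -(leq_pmul2l q0); apply: leq_trans (low _) _; last by rewrite !mulnDr; lia.
    move=> e le1 le2; rewrite inE; apply: middle => //; first by lia.
    have : r * (n * n) <= 12 * r * k.+1 * (n * n) by rewrite leq_mul2r rq orbT.
    by move: le2; rewrite mulnBl; lia.
  rewrite mulnBl => low.
  have r3 : 0 < 3 * r by lia.
  by rewrite -(leq_pmul2l r3); lia.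
have bin0 : 0 < 'C(n, 2) by rewrite bin_gt0.
have big1 : k.+1 * (n + C + 2 * r) + n <= n * n.
  apply: leq_trans big; rewrite leq_add2r.
  have : k.+1 * C <= n * (k.+1 * C) by rewrite leq_pmull //; lia.
  have : k.+1 * r <= n * (k.+1 * r) by rewrite leq_pmull //; lia.
  have : n * k.+1 <= n * (k.+1 * r) by rewrite leq_mul2l leq_pmulr ?orbT //; lia.
  lia.
have big2 : 16 * (k.+1 * r) + n <= n * n.
  apply: leq_trans big; rewrite leq_add2r.
  have : 2 * (k.+1 * r) <= n * (k.+1 * r) by rewrite leq_mul2r n2 orbT.
  lia.
split=> //.
- have : k.+1 * (2 * r * #|S_set n m f|) <= k.+1 * (n * n + C + 2 * r) by rewrite leq_mul2l up.
  lia.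
- lia.
Qed.
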